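(* There exists a unique $\mathbb{Z}[H]$-valued quasipolynomial $\mathcal{C}_H=\sum_{h\in H}\mathcal{C}_h\cdot h$ on the lattice $L'$ (that is, all equivariant parts $\mathcal{C}_h$ are quasipolynomials on $L'$) with the property that $$\mathcal{C}_H(x)=C_H(x)\qquad\text{for all } x\in\sum_{v\in\mathcal{V}}(\delta_v-2)E_v^*+\operatorname{int}(\mathcal{S}').$$ In particular, there are unique quasipolynomials $\mathcal{C}$ and $\mathcal{L}_h$ (for each $h\in H$) on $L'$ such that $$\mathcal{C}(x)=C(x)\quad\text{and}\quad \mathcal{L}_h(x)=Q_h(x)\qquad\text{for all } x\in\sum_{v\in\mathcal{V}}(\delta_v-2)E_v^*+\operatorname{int}(\mathcal{S}').$$
   Context: $\mathcal{T}$ is a finite tree (a connected negative definite plumbing graph with all genera zero) with vertex set $\mathcal{V}$; $\delta_v$ is the valency of $v$. $L=\mathbb{Z}\langle E_v\rangle_{v\in\mathcal{V}}$ is a free lattice with a negative definite integral symmetric form $(\,,\,)$ such that, for $v\ne w$, $(E_v,E_w)=1$ if $\overline{vw}$ is an edge and $0$ otherwise. $L'\subset L\otimes\mathbb{Q}$ is the dual lattice, freely generated by the elements $E_v^*$ defined by $(E_v^*,E_w)=-1$ if $v=w$ and $0$ otherwise (all coordinates of $E_v^*$ in the basis $\{E_w\}$ are positive). $H=L'/L$ is a finite group; $[x]\in H$ is the class of $x\in L'$. $\mathcal{S}'=\mathbb{Z}_{\ge0}\langle E_v^*\rangle_{v\in\mathcal{V}}$ is the Lipman cone, $\mathcal{S}'_{\mathbb{R}}=\mathbb{R}_{\ge0}\langle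 E_v^*\rangle_{v}$, and $\operatorname{int}(\mathcal{S}')=\mathcal{S}'\cap\operatorname{int}(\mathcal{S}'_{\mathbb{R}})=\mathbb{Z}_{>0}\langle E_v^*\rangle_{v}$. For $y=\sum_v y_vE_v\in L'$ and $\emptyset\ne\mathcal{I}\subseteq\mathcal{V}$ put $\mathbf{t}^y=\prod_{v\in\mathcal{V}} t_v^{y_v}$ and $\mathbf{t}_{\mathcal{I}}^{y}=\prod_{v\in\mathcal{I}}t_v^{y_v}$ (so $\mathbf{t}_{\mathcal{I}}^{E_i}=t_i$ for $i\in\mathcal{I}$). Set $f_H(\mathbf{t})=\prod_{v\in\mathcal{V}}(1-[E_v^*]\mathbf{t}^{E_v^*})^{\delta_v-2}$, with coefficients in the group ring $\mathbb{Z}[H]$, and let $f_H(\mathbf{t}_{\mathcal{I}})=\prod_{v\in\mathcal{V}}(1-[E_v^*]\mathbf{t}_{\mathcal{I}}^{E_v^*})^{\delta_v-2}$. $\mathrm{T}[\,\cdot\,]$ denotes Taylor expansion at the origin (each $1/(1-g\,\mathbf{t}_{\mathcal{I}}^{a})$ is expanded as $\sum_{k\ge0}g^k\mathbf{t}_{\mathcal{I}}^{ka}$) and $\mathrm{Coeff}(S,\mathbf{t}_{\mathcal{I}}^{x})$ is the coefficient of $\mathbf{t}_{\mathcal{I}}^x$ in the series $S$. $C_H:L'\to\mathbb{Z}[H]$ is $$C_H(x)=\sum_{\emptyset\ne\mathcal{I}\subseteq\mathcal{V}}(-1)^{|\mathcal{I}|-1}\,\mathrm{Coeff}\Big(\mathrm{T}\Big[f_H(\mathbf{t}_{\mathcal{I}})\prod_{i\in\mathcal{I}}\frac{\mathbf{t}_{\mathcal{I}}^{E_i}}{1-\mathbf{t}_{\mathcal{I}}^{E_i}}\Big],\mathbf{t}_{\mathcal{I}}^{x}\Big),$$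 decomposed as $C_H=\sum_{h\in H}C_h\cdot h$, and $C:L'\to\mathbb{Z}$ is $C(x)=C_{[x]}(x)$. Let $\sum_{l'\in L'}p_{l'}\mathbf{t}^{l'}$ be the Taylor expansion at the origin of $\prod_{v\in\mathcal{V}}(1-\mathbf{t}^{E_v^*})^{\delta_v-2}$ (supported on $\mathcal{S}'$). Write $l'\ge x$ if all coordinates of $l'-x$ in the basis $\{E_v\}$ are $\ge0$. For $h\in H$ the counting function is $Q_h(x)=\sum_{l'\not\ge x,\,[l']=h}p_{l'}$ (a finite sum), $x\in L'$. A quasipolynomial on a lattice is a function whose restriction to each coset of some finite-index sublattice is a polynomial. *)

(* Defs.v *)
From HB Require Import structures.
From mathcomp Require Import all_boot all_order all_algebra.
From mathcomp Require Import generic_quotient ring_quotient.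
From mathcomp Require Import boolp classical_sets fsbigop.
(* Not imported: the notations of multinomials clash with those of
   mathcomp-analysis. *)
From mathcomp Require mpoly.

Set Implicit Arguments.
Unset Strict Implicit.
Unset Printing Implicit Defensive.

Import Order.TTheory GRing.Theory Num.Theory.
Local Open Scope ring_scope.
Local Open Scope quotient_scope.

(** * Group ring of a finite abelian group *)

(* The group H is written additively; an element of Z[H] is the family of its
   coefficients, and the product is convolution (not the pointwise product
   carried by {ffun H -> int}). *)
Definition group_ring (H : finZmodType) : Type := {ffun H -> int}.

HB.instance Definition _ (H : finZmodType) :=
  GRing.Zmodule.on (group_ring H).

Definition gcoef (H : finZmodType) (a : group_ring H) (h : H) : int :=
  (a : {ffun H -> int}) h.

Definition gelt (H : finZmodType) (h : H) : group_ring H :=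
  [ffun k => (k == h)%:R].

Definition gmul (H : finZmodType) (a b : group_ring H) : group_ring H :=
  [ffun h => \sum_(g : H) gcoef a g * gcoef b (h - g)].

Section GroupRingTheory.
Variable H : finZmodType.
Implicit Types a b c : group_ring H.

Fact gmulC : commutative (@gmul H).
Proof.
move=> a b; apply/ffunP => h; rewrite !ffunE.
rewrite (reindex_inj (inv_inj (subKr h))) /=.
by apply: eq_bigr => g _; rewrite subKr mulrC.
Qed.

Fact gmulA : associative (@gmul H).
Proof.
move=> a b c; apply/ffunP => h; rewrite !ffunE.
under eq_bigr => g _ do rewrite /gcoef ffunE mulr_sumr.
under [RHS]eq_bigr => g _ do rewrite /gcoef ffunE mulr_suml.
rewrite [RHS]exchange_big; apply: eq_bigr => g _ /=.
rewrite [RHS](reindex_inj (addrI g)) /=; apply: eq_bigr => k _.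
by rewrite [g + k]addrC addrK mulrA [k + g]addrC opprD addrA.
Qed.

Fact gmul1 : left_id (gelt (0 : H)) (@gmul H).
Proof.
move=> a; apply/ffunP => h; rewrite !ffunE (bigD1 0) //= /gcoef ffunE eqxx.
rewrite mul1r subr0 big1 ?addr0 // => g /negbTE g0.
by rewrite ffunE g0 mul0r.
Qed.

Fact gmulDl : left_distributive (@gmul H) +%R.
Proof.
move=> a b c; apply/ffunP => h; rewrite !ffunE -big_split /=.
by apply: eq_bigr => g _; rewrite /gcoef ffunE mulrDl.
Qed.

Fact gelt_neq0 : gelt (0 : H) != 0.
Proof. by apply/eqP => /ffunP/(_ 0); rewrite !ffunE eqxx. Qed.

HB.instance Definition _ := GRing.Zmodule_isComNzRing.Build (group_ring H)
  gmulA gmulC gmul1 gmulDl gelt_neq0.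

End GroupRingTheory.

(** * Plumbing trees and their lattices *)

Section IntersectionForm.
Variables (V : finType) (e : rel V) (b : V -> int).

Definition intersection (v w : V) : int :=
  if v == w then b v else (e v w)%:R.

(* An element y of L (x) Q is given by its coordinates in the basis (E_v). *)
Definition iform (y z : {ffun V -> rat}) : rat :=
  \sum_v \sum_w y v * z w * (intersection v w)%:~R.

End IntersectionForm.

Record plumbing_tree := PlumbingTree {
  vertex : finType;
  edge : rel vertex;
  euler : vertex -> int;
  edge_sym : symmetric edge;
  edge_irr : irreflexive edge;
  vertex_gt0 : (0 < #|vertex|)%N;
  edge_connected : forall v w, connect edge v w;
  (* [cycle] also accepts v - w - v, of size 2 *)
  edge_acyclic : forall p : seq vertex,
    cycle edge p -> uniq p -> (size p <= 2)%N;
  negative_definite : forall y : {ffun vertex -> rat},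
    y != 0 -> iform edge euler y y < 0
}.

Section Lattices.
Variable T : plumbing_tree.
Local Notation V := (vertex T).
Local Notation LQ := {ffun V -> rat}.

Definition valency (v : V) : nat := #|[pred w | edge v w]|.

Definition form : LQ -> LQ -> rat := iform (@edge T) (@euler T).

Definition E (v : V) : LQ := [ffun w => (w == v)%:R].

Definition imatrix : 'M[rat]_#|V| :=
  \matrix_(i, j)
    (intersection (@edge T) (@euler T) (enum_val i) (enum_val j))%:~R.

Definition Estar (v : V) : LQ :=
  [ffun w => - invmx imatrix (enum_rank v) (enum_rank w)].

Definition in_dual : {pred LQ} :=
  fun y => [forall w, form y (E w) \is a Num.int].

Lemma formE (y : LQ) w :
  form y (E w) =
  \sum_v y v * (intersection (@edge T) (@euler T) v w)%:~R.
Proof.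
apply: eq_bigr => v _; rewrite (bigD1 w) //= ffunE eqxx mulr1.
by rewrite big1 ?addr0 // => u /negbTE uw; rewrite ffunE uw mulr0 mul0r.
Qed.

Lemma sum_imatrix (x : 'I_#|V| -> rat) w :
  \sum_v x (enum_rank v) * (intersection (@edge T) (@euler T) v w)%:~R
  = \sum_j x j * imatrix j (enum_rank w).
Proof.
rewrite [RHS](reindex (@enum_rank V)) /=; last first.
  by exists enum_val => i _; rewrite ?enum_rankK ?enum_valK.
by apply: eq_bigr => v _; rewrite !mxE !enum_rankK.
Qed.

Lemma imatrix_unit : imatrix \in unitmx.
Proof.
rewrite unitmxE unitfE; apply/negP => /det0P[u u0 uM].
pose y : LQ := [ffun v => u 0 (enum_rank v)].
have y0 : y != 0.
  apply: contra_neq u0 => /ffunP y0; apply/rowP => i.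
  by move: (y0 (enum_val i)); rewrite !ffunE enum_valK mxE.
suff f0 : iform (@edge T) (@euler T) y y = 0.
  by have := @negative_definite T y y0; rewrite f0 ltxx.
rewrite /iform exchange_big big1 //= => w _.
have /rowP/(_ (enum_rank w)) := uM; rewrite !mxE.
have <- := sum_imatrix (u 0) w => uMw.
transitivity (y w * 0); last exact: mulr0.
rewrite -[in RHS]uMw mulr_sumr; apply: eq_bigr => v _.
by rewrite ffunE mulrA [_ * y w]mulrC.
Qed.

Lemma form_Estar v w : form (Estar v) (E w) = - (v == w)%:R.
Proof.
rewrite formE; under eq_bigr => u _ do rewrite ffunE.
rewrite (sum_imatrix (fun j => - invmx imatrix (enum_rank v) j)).
under eq_bigr => j _ do rewrite mulNr.
rewrite sumrN; congr (- _).
have /matrixP/(_ (enum_rank v) (enum_rank w)) := mulVmx imatrix_unit.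
by rewrite !mxE (inj_eq enum_rank_inj).
Qed.

Fact in_dual_zmod : zmod_closed in_dual.
Proof.
split=> [|y z /forallP yL /forallP zL]; apply/forallP => w; rewrite formE.
  by apply: rpred_sum => v _; rewrite ffunE mul0r rpred0.
have -> : \sum_v (y - z) v * (intersection (@edge T) (@euler T) v w)%:~R
    = form y (E w) - form z (E w).
  by rewrite !formE -sumrB; apply: eq_bigr => v _; rewrite !ffunE mulrBl.
exact: rpredB.
Qed.

HB.instance Definition _ := GRing.isZmodClosed.Build LQ in_dual in_dual_zmod.

Record dual_lattice : Type :=
  DualLattice { dval :> LQ; dvalP : dval \in in_dual }.

HB.instance Definition _ := [isSub for dval].
HB.instance Definition _ := [Choice of dual_lattice by <:].
HB.instance Definition _ := [SubChoice_isSubZmodule of dual_lattice by <:].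

Fact Estar_dual v : Estar v \in in_dual.
Proof. by apply/forallP => w; rewrite form_Estar rpredN rpred_nat. Qed.

Definition dEstar (v : V) : dual_lattice := DualLattice (Estar_dual v).

(* The sublattice L of L'. *)
Definition in_L : {pred dual_lattice} :=
  fun y => [forall v, y v \is a Num.int].

Fact in_L_zmod : zmod_closed in_L.
Proof.
split=> [|y z /forallP yL /forallP zL]; apply/forallP => v.
  by rewrite ffunE rpred0.
by rewrite !ffunE rpredB.
Qed.

HB.instance Definition _ :=
  GRing.isZmodClosed.Build dual_lattice in_L in_L_zmod.

Definition discr : Type := {ideal_quot in_L}.

HB.instance Definition _ := GRing.Zmodule.on discr.

Definition cls (x : dual_lattice) : discr := \pi_({ideal_quot in_L}) x.


Definition zmatrix : 'M[int]_#|V| := \matrix_(i, j)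
  intersection (@edge T) (@euler T) (enum_val i) (enum_val j).

Lemma imatrixE : imatrix = map_mx intr zmatrix.
Proof. by apply/matrixP => i j; rewrite !mxE. Qed.

Lemma det_zmatrix_neq0 : \det zmatrix != 0.
Proof.
have := imatrix_unit; rewrite unitmxE unitfE imatrixE det_map_mx.
by rewrite intr_eq0.
Qed.

Lemma det_dual (x : dual_lattice) v : (\det zmatrix)%:~R * x v \is a Num.int.
Proof.
pose u : 'rV[rat]_#|V| := \row_j x (enum_val j).
have uE : u *m imatrix *m \adj imatrix = (\det zmatrix)%:~R *: u.
  by rewrite -mulmxA mul_mx_adj mul_mx_scalar imatrixE det_map_mx.
have /rowP/(_ (enum_rank v)) := uE; rewrite [RHS]mxE [u _ _]mxE enum_rankK.
move=> <-; rewrite mxE; apply: rpred_sum => j _; apply: rpredM.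
  rewrite mxE; have -> : \sum_k u 0 k * imatrix k j = form x (E (enum_val j)).
    rewrite formE -[j in LHS]enum_valK -sum_imatrix; apply: eq_bigr => w _.
    by rewrite mxE enum_rankK.
  by have /forallP := dvalP x.
by rewrite imatrixE -map_mx_adj mxE intr_int.
Qed.

(* The determinant of the form kills L'/L, so a class is determined by the
   residues modulo this determinant of the scaled coordinates of any of its
   representatives. *)
Definition discr_code (h : discr) : {ffun V -> 'I_`|\det zmatrix|.-1.+1} :=
  [ffun v => inord `|(Num.floor ((\det zmatrix)%:~R
                        * (repr (h : {ideal_quot in_L}) : dual_lattice) v)
                     %% \det zmatrix)%Z|%N].

Fact discr_code_inj : injective discr_code.
Proof.
move=> h k /ffunP hk; rewrite -[h]reprK -[k]reprK; apply/eqP.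
rewrite -Quotient.idealrBE; apply/forallP => v.
set x : dual_lattice := repr _; set y : dual_lattice := repr _.
have D0 := det_zmatrix_neq0.
move: hk; rewrite /discr_code -/x -/y; move: (@det_dual); move: (\det zmatrix) D0 => D D0 Dint hk.
have DQ0 : D%:~R != 0 :> rat by rewrite intr_eq0.
have bnd (z : int) : (`|(z %% D)%Z|%N < `|D|.-1.+1)%N.
  rewrite prednK ?absz_gt0 // -ltz_nat gez0_abs ?modz_ge0 //.
  by rewrite abszE ltz_mod.
have := congr1 (@nat_of_ord _) (hk v); rewrite !ffunE !inordK ?bnd // => /(congr1 Posz).
rewrite !gez0_abs ?modz_ge0 // => /eqP; rewrite eqz_mod_dvd => /dvdzP[q qE].
have fl (z : dual_lattice) : (Num.floor (D%:~R * z v))%:~R = D%:~R * z v.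
  by apply/floorK/Dint.
have : D%:~R * (x v - y v) = D%:~R * q%:~R :> rat.
  by rewrite mulrBr -(fl x) -(fl y) -rmorphB /= qE rmorphM mulrC.
by move=> /(mulfI DQ0) xyq; rewrite [_ - _]xyq intr_int.
Qed.


Definition discr_decode (c : {ffun V -> 'I_`|\det zmatrix|.-1.+1}) :
    option discr :=
  if pselect (exists h, discr_code h == c) is left hc
  then Some (xchoose hc) else None.

Fact discr_codeK : pcancel discr_code discr_decode.
Proof.
move=> h; rewrite /discr_decode; case: pselect => [hc|[]]; last by exists h.
by congr Some; apply/discr_code_inj/eqP/(xchooseP hc).
Qed.

HB.instance Definition _ := PCanIsCountable discr_codeK.
HB.instance Definition _ : isFinite discr := PCanIsFinite discr_codeK.

End Lattices.

(** * Formal series with rational exponents *)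

Section Series.
Variables (V : finType) (R : comNzRingType).

(* A series is the function sending an exponent to its coefficient. *)
Definition series : Type := {ffun V -> rat} -> R.

Definition smono (c : R) (a : {ffun V -> rat}) : series :=
  fun y => if y == a then c else 0.

Definition sone : series := smono 1 0.

(* Cauchy product.  All the series below are supported on the nonnegative
   combinations of finitely many exponents a >= 0, a != 0, so the sum has
   finite support. *)
Definition smul (A B : series) : series :=
  fun y => \sum_(z \in [set: {ffun V -> rat}]%classic) A z * B (y - z).

Definition spow (A : series) (n : nat) : series := iter n (smul A) sone.

(* 1 / (1 - g t^a) = \sum_(k >= 0) g^k t^(k a); at a given exponent at most
   one term is nonzero when a != 0. *)
Definition sgeom (g : R) (a : {ffun V -> rat}) : series :=
  fun y => \sum_(k \in [set: nat]%classic) smono (g ^+ k) (a *+ k) y.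

(* T[(1 - g t^a)^m] *)
Definition sbinom (g : R) (a : {ffun V -> rat}) (m : int) : series :=
  match m with
  | Posz n => spow (fun y => sone y - smono g a y) n
  | Negz n => spow (sgeom g a) n.+1
  end.

(* The variables t_v with v outside I are set to 1: an exponent y becomes its
   restriction to I, encoded by its extension by zero. *)
Definition res (I : {set V}) (y : {ffun V -> rat}) : {ffun V -> rat} :=
  [ffun v => if v \in I then y v else 0].

End Series.

Section Counting.
Variable T : plumbing_tree.
Local Notation V := (vertex T).
Local Notation L' := (dual_lattice T).
Local Notation H := (discr T).

Definition excess (v : V) : int := (valency v)%:Z - 2.

(* T[\prod_v (1 - g_v t^(a_v))^(delta_v - 2)] *)
Definition fseries (R : comNzRingType) (g : V -> R)
    (a : V -> {ffun V -> rat}) : series V R :=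
  \big[@smul V R/@sone V R]_(v : V) sbinom (g v) (a v) (excess v).

Definition fH (I : {set V}) : series V (group_ring H) :=
  fseries (fun v => gelt (cls (dEstar v))) (fun v => res I (Estar v)).

Definition tail (I : {set V}) : series V (group_ring H) :=
  \big[@smul V (group_ring H)/@sone V (group_ring H)]_(i in I)
    smul (smono 1 (res I (E i))) (sgeom 1 (res I (E i))).

Definition C_H (x : L') : group_ring H :=
  \sum_(I : {set V} | I != finset.set0)
    (-1) ^+ (#|I| - 1) * smul (fH I) (tail I) (res I x).

Definition C (x : L') : int := gcoef (C_H x) (cls x).

Definition pcoef : series V int := fseries (fun=> 1) (@Estar T).

Definition Q (h : H) (x : L') : int :=
  \sum_(l \in [set l : L' | ~ (forall v, 0 <= (l - x) v) /\ cls l = h]%classic)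
    pcoef l.

Definition int_lipman : set L' :=
  [set x | exists2 m : V -> nat,
     forall v, (0 < m v)%N & x = \sum_v dEstar v *+ m v]%classic.

Definition chamber : set L' :=
  [set x | exists2 s, int_lipman s
         & x = \sum_v dEstar v *~ excess v + s]%classic.

Definition finite_index (M : {pred L'}) : Prop :=
  exists reps : seq L', forall x, exists2 r, r \in reps & x - r \in M.

Definition quasipolynomial (f : L' -> rat) : Prop :=
  exists M : {pred L'}, [/\ zmod_closed M, finite_index M &
    forall x0 : L', exists P : mpoly.mpoly #|V| rat,
      forall x : L', x - x0 \in M ->
        f x = mpoly.meval (fun i => x (enum_val i)) P].

Definition equivariant_quasipolynomial (F : L' -> group_ring H) : Prop :=
  forall h : H, quasipolynomial (fun x => (gcoef (F x) h)%:~R).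

End Counting.

(* Main.v *)
From Pilot Require Import Defs.
From mathcomp Require Import all_boot all_order all_algebra.
From mathcomp Require Import boolp classical_sets.
From mathcomp Require Import fsbigop zify ring lra.
From mathcomp Require mpoly.
Import (canonicals) mpoly.
Import Pilot.Defs.

(** Let c_w(n) be the coefficient of t^n in (1 - t)^(valency w - 2); it is the
    (valency w)-fold backward difference of the ramp max(n + 1, 0).  Writing
    hat l w = - (l, E_w), a point l of L' is the sum of the hat l w * Estar w,
    so p_l is the product of the c_w (hat l w) ([tree_coef]).  Inclusion and
    exclusion over the sets I turns the h-part of C_H (x) into the sum of the
    p_l over the l of class h having l_i < x_i for some i in J, where J is the
    set of the i at which x is congruent to the class h modulo 1; for Q_h the
    set J is the whole vertex set ([C_H_count_below], [Q_count_below]).  So all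
    the functions of the theorem are instances of [count_below].

    The heart of the proof is that the mixed second differences of
    [count_below] in the directions N Estar u and N Estar w, for a suitable N,
    are the same at all the points of the chamber ([count_below_mixed]).  Then,
    on the intersection of the chamber with a coset of N L', the function is
    an explicit quadratic polynomial, which extends it to the whole coset
    ([extension_quasipolynomial]).  Uniqueness and integrality hold because a
    polynomial in one variable whose values at large integers are 0 (are
    integers) has this property at all integers, and every line in an interior
    direction of the cone ends in the chamber ([poly_tail],
    [quasipolynomial_eq], [quasipolynomial_int]).

    For the mixed differences, replace x by the least point y >= x of the
    class h, and follow the segment from x to x + N Estar u, rounding up its
    points: y moves to y + N Estar u by unit steps E_v ([path_step]).  A step
    with v in J adds to [count_below] the sum of the p_l over the slice
    l_v = y_v, l_w >= y_w for w in J.  Translation by N Estar w has the same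
    effect on such a slice as translation by some d whose pairings hat d j
    vanish off J and are nonnegative ([period_exists]).  So everything follows
    from [slice_sum_increment]: a translation of y by Estar j, with j in J,
    changes the sum over the slice by 1 if j = v, and by 0 otherwise.

    That increment is the slice sum with c_j replaced by its difference.  It is
    evaluated by summing over the coordinates of l one vertex at a time,
    stripping the leaves of the tree towards the root v.  The factor carried by
    a remaining vertex w is an iterated difference of a sequence which is
    finally linear, of slope 1, or 0 if j has been absorbed in w.  Let a be the
    point of the segment that is being rounded to y, so that y - a has its
    coordinates in [0, 1] and vanishes at v, and let z = Estar v.  As
    (z, E_w) = 0 for w <> v, the inequalities defining the chamber imply
    that the factor of w has reached its final regime as soon as the slope
    (l_w - a_w) / z_w is at least that of the neighbour of w nearer to v
    ([thresholds_le_height]).  Along the path from j to v the final value is 0,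
    so that in a nonzero term the slopes increase strictly from j to v; but the
    slope is at least 0 at j, and it is 0 at v. *)

Set Implicit Arguments.
Unset Strict Implicit.
Unset Printing Implicit Defensive.

Import Order.TTheory GRing.Theory Num.Theory.
Local Open Scope ring_scope.

(** * Backward differences and convolutions *)

Definition nabla (R : int -> int) (n : int) : int := R n - R (n - 1).

(** The coefficients of 1 / (1 - t)^2: every vertex factor (1 - t)^(valency - 2)
    is an iterated difference of this one sequence. *)
Definition ramp (n : int) : int := if 0 <= n then n + 1 else 0.

Definition vanish_neg (R : int -> int) := forall n, n < 0 -> R n = 0.

(** The sequence \sum_k g k * nabla R (n - k), for R vanishing on the negative
    integers, so that only the k <= n contribute.  It is the result of summing
    over a leaf; the extra difference accounts for the lost edge. *)
Definition conv (g : nat -> int) (R : int -> int) (n : int) : int :=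
  \sum_(k < `|n|.+1) g k * nabla R (n - k%:Z).

Lemma nabla_vanish R : vanish_neg R -> vanish_neg (nabla R).
Proof. by move=> R0 n n0; rewrite /nabla !R0 //; lia. Qed.

Lemma iter_nabla_vanish m R : vanish_neg R -> vanish_neg (iter m nabla R).
Proof. by move=> R0; elim: m => //= m IH; apply: nabla_vanish. Qed.

Lemma sum_nat_widen (F : nat -> int) B1 B2 :
  (forall k, (B1 <= k)%N -> F k = 0) -> (B1 <= B2)%N ->
  \sum_(k < B2) F k = \sum_(k < B1) F k.
Proof.
move=> F0 le; rewrite (big_ord_widen B2 F le) [RHS]big_mkcond /=.
by apply: eq_bigr => i _; case: ltnP => // /F0.
Qed.

Lemma conv_widen g R n (B : nat) : vanish_neg R -> n < B%:Z ->
  conv g R n = \sum_(k < B) g k * nabla R (n - k%:Z).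
Proof.
move=> /nabla_vanish R0 nB; rewrite /conv.
have H k : (k%:Z > n) -> g k * nabla R (n - k%:Z) = 0.
  by move=> nk; rewrite R0 ?mulr0 //; lia.
case: (leP 0 n) => n0.
  rewrite -(@sum_nat_widen (fun k => g k * nabla R (n - k%:Z)) `|n|.+1 B) //;
    first by move=> k Hk; apply: H; lia.
  by lia.
by rewrite !big1 // => i _; apply: H; lia.
Qed.

Lemma conv_vanish g R : vanish_neg R -> vanish_neg (conv g R).
Proof.
by move=> R0 n n0; rewrite (@conv_widen _ _ _ 0) ?big_ord0.
Qed.

Lemma iter_nablaS m R n :
  iter m.+1 nabla R n = iter m nabla R n - iter m nabla R (n - 1).
Proof. by []. Qed.

Lemma iter_nabla_conv m g R n (B : nat) : vanish_neg R -> n < B%:Z ->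
  iter m nabla (conv g R) n
  = \sum_(k < B) g k * iter m.+1 nabla R (n - k%:Z).
Proof.
move=> R0; elim: m n => [|m IH] n nB; first exact: conv_widen.
have nB1 : n - 1 < B%:Z by lia.
rewrite iter_nablaS (IH _ nB) (IH _ nB1) -sumrB; apply: eq_bigr => k _.
rewrite -mulrBr (iter_nablaS m.+1) (_ : n - 1 - k%:Z = n - k%:Z - 1) //.
by ring.
Qed.

Lemma sum_nabla_tail g (X : int -> int) (c : int) n (e B : nat) :
  (forall k, (e <= k)%N -> g k = c) ->
  (forall k, (k < e)%N -> nabla X (n - k%:Z) = 0) ->
  X (n - B%:Z) = 0 -> (e <= B)%N ->
  \sum_(k < B) g k * nabla X (n - k%:Z) = c * X (n - e%:Z).
Proof.
move=> gc X0 XB eB.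
have H i : \sum_(k < e + i) g k * nabla X (n - k%:Z)
           = c * (X (n - e%:Z) - X (n - (e + i)%N%:Z)).
  elim: i => [|i IH].
    by rewrite addn0 subrr mulr0 big1 // => k _; rewrite X0 ?mulr0.
  rewrite addnS big_ord_recr /= IH gc ?leq_addr // /nabla -mulrDr.
  by congr (_ * _); rewrite (_ : n - (e + i)%N%:Z - 1 = n - (e + i).+1%:Z); [ring|lia].
by have := H (B - e)%N; rewrite subnKC // XB subr0.
Qed.

(** Below the threshold e of g the second differences of R have died out, and
    beyond it the sum telescopes: final slopes multiply, and thresholds add. *)
Lemma nabla_conv g R (al c d n : int) (e : nat) : vanish_neg R ->
  (forall n, d <= n -> nabla R n = al) -> (forall k, (e <= k)%N -> g k = c) ->
  d + e%:Z <= n -> nabla (conv g R) n = c * al.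
Proof.
move=> R0 Rd gc dn.
have nB : n < (e + `|n|.+1)%N%:Z by lia.
rewrite -[LHS]/(iter 1 nabla (conv g R) n) (iter_nabla_conv _ _ R0 nB).
rewrite (@sum_nabla_tail _ (nabla R) c _ e) ?leq_addr // => [|k ke|].
- by rewrite Rd //; lia.
- by rewrite {1}/nabla !Rd ?subrr //; lia.
- by apply: (nabla_vanish R0); lia.
Qed.

Lemma conv_const1 g R (d n : int) (e : nat) : vanish_neg R ->
  (forall n, d - 1 <= n -> R n = 1) -> (forall k, (e <= k)%N -> g k = 1) ->
  d + e%:Z - 1 <= n -> conv g R n = 1.
Proof.
move=> R0 Rd gc dn.
have nB : n < (e + `|n|.+1)%N%:Z by lia.
rewrite (conv_widen _ R0 nB) (@sum_nabla_tail _ R 1 _ e) ?leq_addr // => [|k ke|].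
- by rewrite Rd ?mulr1 //; lia.
- by rewrite /nabla !Rd ?subrr //; lia.
- by apply: R0; lia.
Qed.

Lemma ramp_vanish : vanish_neg ramp.
Proof. by move=> n n0; rewrite /ramp leNgt n0. Qed.

Lemma nabla_ramp n : 0 <= n -> nabla ramp n = 1.
Proof. by move=> n0; rewrite /nabla /ramp n0; case: leP; lia. Qed.

Lemma conv0 g R n : (forall n, R n = 0) -> conv g R n = 0.
Proof.
by move=> R0; rewrite /conv big1 // => i _; rewrite /nabla !R0 subrr mulr0.
Qed.

Lemma conv_neq0 g R n : conv g R n != 0 -> exists i, g i != 0.
Proof.
move=> cn; apply: contrapT => nex; move/negP: cn; apply; apply/eqP.
apply: big1 => i _; suff -> : g i = 0 by rewrite mul0r.
by apply: contrapT => /eqP gi; apply: nex; exists i.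
Qed.

(** * Sums over boxes *)

Section Box.
Variables (V : finType) (M : nat).
Local Notation box := {ffun V -> 'I_M.+1}.

Definition supported (S : {set V}) (k : box) : bool :=
  [forall w, (w \notin S) ==> (k w == ord0)].

Definition upd (T : Type) (k : V -> T) (w : V) (i : T) : V -> T :=
  fun u => if u == w then i else k u.

(** Fubini for the coordinate w.  The summand is a function of arbitrary natural
    coordinates, so that it can be evaluated outside of the box. *)
Lemma sum_box_peel (U : nmodType) (S : {set V}) w (F : (V -> nat) -> U) : w \notin S ->
  (forall k k', k =1 k' -> F k = F k') ->
  \sum_(k : box | supported (w |: S) k) F (fun u => k u)
  = \sum_(k : box | supported S k) \sum_(i < M.+1) F (upd (fun u => k u : nat) w i).
Proof.
move=> wS Fext.
rewrite pair_big_dep /=.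
rewrite (reindex_onto (fun k : box => ([ffun u => if u == w then ord0 else k u]
  : box, k w))
   (fun p : box * 'I_M.+1 => [ffun u => upd p.1 w p.2 u] : box)); last first.
  move=> [k i] /= /andP[/forallP ks _]; congr pair; last by rewrite ffunE /upd eqxx.
  apply/ffunP => u; rewrite !ffunE /upd; case: eqP => // ->.
  by have := ks w; rewrite wS => /eqP.
apply: eq_big => [k|k _]; last first.
  by apply: Fext => u; rewrite /upd /= ffunE; case: eqP => // ->.
have -> : [ffun u => upd [ffun u0 => if u0 == w then ord0 else k u0] w (k w) u] = k.
  by apply/ffunP => u; rewrite !ffunE /upd ffunE; case: eqP => // ->.
rewrite eqxx !andbT; apply: eq_forallb => u; rewrite ffunE !inE.
by case: (altP (u =P w)) => [->|] /=; rewrite ?wS ?eqxx.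
Qed.

Lemma sum_box_setT (U : nmodType) (F : box -> U) :
  \sum_(k : box | supported finset.setT k) F k = \sum_(k : box) F k.
Proof. by apply: eq_bigl => k; apply/forallP => u; rewrite inE. Qed.

Lemma sum_box_set1 (U : nmodType) v (F : (V -> nat) -> U) : 
  (forall k k', k =1 k' -> F k = F k') ->
  \sum_(k : box | supported [set v]%SET k) F (fun u => k u)
  = \sum_(i < M.+1) F (upd (fun=> 0%N) v i).
Proof.
move=> Fext; rewrite -[X in supported X](finset.setU0 [set v]%SET) sum_box_peel ?inE //.
rewrite (big_pred1 [ffun=> ord0]) => [|k].
  by apply: eq_bigr => i _; apply: Fext => u; rewrite /upd ffunE.
apply/forallP/eqP => [H|-> u]; last by rewrite ffunE eqxx implybT.
by apply/ffunP => u; rewrite ffunE; have := H u; rewrite inE => /eqP.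
Qed.

End Box.

(** * Trees as successive additions of leaves *)

Section Rooted.
Variables (T : plumbing_tree) (v : vertex T).
Local Notation V := (vertex T).

(** A finite tree is obtained from its root by adding leaves one by one; this
    gives the order in which the leaves are stripped. *)
Inductive rooted : {set V} -> Prop :=
| rooted1 : rooted [set v]%SET
| rootedU S w u : rooted S -> w \notin S -> u \in S -> edge w u ->
    (forall x, x \in S -> edge w x -> x = u) -> rooted (w |: S)%SET.

Definition inner_edge (S : {set V}) : rel V :=
  [rel x y | [&& edge x y, x \in S & y \in S]].

Lemma inner_edge_sym S : symmetric (inner_edge S).
Proof.
by move=> x y; rewrite /inner_edge /= (edge_sym x y) [(x \in S) && _]andbC.
Qed.

Lemma inner_edgeS (S S' : {set V}) : S \subset S' ->
  subrel (connect (inner_edge S)) (connect (inner_edge S')).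
Proof.
move=> /fintype.subsetP sS; apply: connect_sub => x y /= /and3P[exy xS yS].
by apply: connect1; apply/and3P; rewrite !sS.
Qed.

Lemma rooted_connect S : rooted S ->
  v \in S /\ (forall x, x \in S -> connect (inner_edge S) v x).
Proof.
elim=> [|{}S w u _ [vS IH] wS uS ewu _].
  by split=> [|x]; rewrite inE // => /eqP->.
split=> [|x]; first by rewrite inE vS orbT.
have sub := inner_edgeS (finset.subsetUr [set w]%SET S).
rewrite !inE => /orP[/eqP-> | xS]; last exact/sub/IH.
apply: connect_trans (sub _ _ (IH _ uS)) _; apply: connect1.
by apply/and3P; rewrite !inE eqxx uS orbT edge_sym.
Qed.

(** A second neighbour would close a cycle through a path inside S. *)
Lemma rooted_unique_nbr S w x u : rooted S -> w \notin S ->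
  x \in S -> u \in S -> edge w x -> edge w u -> x = u.
Proof.
move=> /rooted_connect[vS vc] wS xS uS ewx ewu.
have csym : connect_sym (inner_edge S).
  by apply: sym_connect_sym; apply: inner_edge_sym.
have : connect (inner_edge S) u x.
  by apply: connect_trans (vc _ xS); rewrite csym; apply: vc.
case/connectP=> p0 pth0 xE; move: xS ewx; rewrite {x}xE.
case/shortenP: pth0 => p pth un _ {p0} xS ewx.
have pS : all [in S] (u :: p).
  rewrite /= uS; elim: (p) (u) pth {un xS ewx} => //= y q IH z.
  by move=> /andP[/and3P[_ _ yS] qp]; rewrite yS; apply: IH qp.
have pe : path (@edge T) u p by apply: sub_path pth => ? ? /and3P[].
have cy : cycle (@edge T) (w :: u :: p).
  by rewrite /= ewu rcons_path pe /= edge_sym.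
have uq : uniq (w :: u :: p).
  rewrite cons_uniq un andbT; apply: contra wS.
  by move/allP: pS => /[apply].
by have := edge_acyclic cy uq; case: (p).
Qed.

(** Connectedness provides an edge leaving a proper rooted subset. *)
Lemma rootedT : rooted [set: V]%SET.
Proof.
suff H n S : rooted S -> (#|~: S| = n)%N -> rooted [set: V]%SET.
  exact: (H _ _ rooted1 erefl).
elim: n S => [|n IH] S rS cS.
  suff -> : [set: V]%SET = S by [].
  by apply/esym/eqP; rewrite -finset.subTset -finset.setCS finset.setCT
    (cards0_eq cS) finset.sub0set.
have [vS _] := rooted_connect rS.
have [w wS [u uS ewu]] : exists2 w, w \notin S & exists2 u, u \in S & edge w u.
  have /card_gt0P[x] : (0 < #|~: S|)%N by rewrite cS.
  rewrite inE => xS; apply: contrapT => nex.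
  have cl : closed (@edge T) S.
    apply: (intro_closed (sym_connect_sym (@edge_sym T))) => y z eyz yS.
    apply: contrapT => /negP zS; apply: nex; exists z => //; exists y => //.
    by rewrite edge_sym.
  by have := closed_connect cl (edge_connected v x); rewrite vS (negbTE xS).
have rS' := rootedU rS wS uS ewu (fun x xS ewx => rooted_unique_nbr rS wS xS uS ewx ewu).
apply: IH rS' _; rewrite finset.setCU finset.setIC -finset.setDE.
by have := cardsD1 w (~: S)%SET; rewrite inE wS cS => -[].
Qed.

End Rooted.

(** * Summation over a leaf *)

Section Stripping.
Variables (T : plumbing_tree).
Local Notation V := (vertex T).
Variables (al : V -> int) (M : nat).

Definition inner_deg (S : {set V}) (w : V) : nat :=
  #|[pred u | (u \in S) && edge w u]|.

(** The argument - (l, E_w) of the factor of w when the neighbours of w outside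
    of S have been summed over; al w is the contribution of the base point. *)
Definition height (S : {set V}) (k : V -> nat) (w : V) : int :=
  al w - euler w * (k w)%:Z - \sum_(u | (u \in S) && edge w u) (k u)%:Z.

Definition weight (S : {set V}) (R : V -> nat -> int -> int) (k : V -> nat) :
    int :=
  \prod_(w in S) iter (inner_deg S w) nabla (R w (k w)) (height S k w).

Definition leaf_step (R : V -> nat -> int -> int) (w : V) (k i : nat) : int :=
  nabla (R w i) (al w - euler w * i%:Z - k%:Z).

Definition strip (R : V -> nat -> int -> int) (w u : V) :
    V -> nat -> int -> int :=
  fun x k => if x == u then conv (leaf_step R w k) (R u k) else R x k.

(** Guarantees that restricting all the coordinates to the box loses no term. *)
Definition boxed (S : {set V}) (R : V -> nat -> int -> int) :=
  forall k, weight S R k != 0 -> forall x, x \in S -> (k x < M.+1)%N.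

Lemma weight_ext (S : {set V}) R k k' : (forall x, x \in S -> k x = k' x) ->
  weight S R k = weight S R k'.
Proof.
move=> kk; apply: eq_bigr => w wS; rewrite kk //; congr (iter _ _ _ _).
rewrite /height kk //; congr (_ - _); apply: eq_bigr => u /andP[uS _].
by rewrite kk.
Qed.

Section Step.
Variables (S : {set V}) (w u : V) (R : V -> nat -> int -> int).
Hypotheses (wS : w \notin S) (uS : u \in S) (ewu : edge w u)
  (uniq_nbr : forall x, x \in S -> edge w x -> x = u).

Lemma neq_leaf x : x \in S -> (x == w) = false.
Proof. by move=> xS; apply: contraNF wS => /eqP<-. Qed.

Lemma edge_leaf x : x \in S -> edge x w = (x == u).
Proof.
move=> xS; rewrite edge_sym; apply/idP/eqP => [/uniq_nbr->//|->//].
Qed.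

Lemma inner_degU x : x \in S ->
  inner_deg (w |: S)%SET x = ((x == u) + inner_deg S x)%N.
Proof.
move=> xS; rewrite /inner_deg -edge_leaf //.
rewrite (cardD1 w) inE /= !inE eqxx /=; congr addn.
by apply: eq_card => y; rewrite !inE; case: eqP => //= ->; rewrite (negbTE wS).
Qed.

Lemma heightU (k : V -> nat) (i : nat) x : x \in S ->
  height (w |: S)%SET (upd k w i) x = height S k x - (x == u)%:Z * i%:Z.
Proof.
move=> xS; rewrite /height /upd neq_leaf // -[RHS]addrA -opprD; congr (_ - _).
rewrite -(edge_leaf xS).
rewrite (bigID (pred1 w)) /= addrC; congr (_ + _).
  apply: eq_big => [y|y]; last by case/andP => _ /negbTE->.
  by rewrite !inE; case: eqP => [->|]; rewrite ?(negbTE wS) ?andbF ?andbT.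
case: (boolP (edge x w)) => exw /=.
  rewrite (big_pred1 w) ?eqxx ?mul1r // => y.
  by rewrite !inE; case: eqP => [->|_]; rewrite ?exw ?andbF.
rewrite big_pred0 ?mul0r // => y.
by rewrite !inE; case: eqP => [->|_]; rewrite ?(negbTE exw) ?andbF.
Qed.

Lemma weightU (k : V -> nat) (i : nat) :
  weight (w |: S)%SET R (upd k w i)
  = leaf_step R w (k u) i *
    \prod_(x in S) iter ((x == u) + inner_deg S x)%N nabla (R x (k x))
       (height S k x - (x == u)%:Z * i%:Z).
Proof.
rewrite /weight big_setU1 //=; congr (_ * _); last first.
  apply: eq_bigr => x xS; rewrite inner_degU // heightU //.
  by rewrite {1}/upd neq_leaf.
have nbr y : (y \in (w |: S)%SET) && edge w y = (y == u).
  rewrite !inE; apply/idP/eqP => [/andP[/orP[/eqP->|yS]]|->].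
  - by rewrite edge_irr.
  - by move/(uniq_nbr yS).
  - by rewrite uS orbT.
have -> : inner_deg (w |: S)%SET w = 1%N.
  by rewrite /inner_deg -(card1 u); apply: eq_card => y; rewrite inE /= nbr.
rewrite /= /leaf_step /height (big_pred1 u) => [|y]; last exact: nbr.
by rewrite /upd eqxx neq_leaf.
Qed.

(** Since the neighbour u loses an edge, its factor has one difference less; the
    difference reappears in the convolution that sums over the leaf. *)
Lemma weight_strip (k : V -> nat) : (forall x k, x \in S -> vanish_neg (R x k)) ->
  boxed (w |: S)%SET R ->
  \sum_(i < M.+1) weight (w |: S)%SET R (upd k w i) = weight S (strip R w u) k.
Proof.
move=> R0 bx.
pose n := height S k u.
pose rest := \prod_(x in S | x != u)
   iter (inner_deg S x) nabla (R x (k x)) (height S k x).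
pose t i := leaf_step R w (k u) i * iter (inner_deg S u).+1 nabla (R u (k u)) (n - i%:Z).
have wE i : weight (w |: S)%SET R (upd k w i) = rest * t i.
  rewrite weightU (bigD1 u) //= eqxx add1n mul1r mulrA mulrC; congr (_ * _).
  by apply: eq_bigr => x /andP[_ /negbTE->]; rewrite add0n mul0r subr0.
have -> : weight S (strip R w u) k
    = rest * iter (inner_deg S u) nabla (conv (leaf_step R w (k u)) (R u (k u))) n.
  rewrite /weight (bigD1 u) //= mulrC /strip eqxx; congr (_ * _).
  by apply: eq_bigr => x /andP[_ /negbTE->].
under eq_bigr => i _ do rewrite wE.
rewrite -mulr_sumr; have [->|rest0] := eqVneq rest 0; first by rewrite !mul0r.
(* The convolution has more terms than the box when n > M; the others are
   zero because rest does not vanish. *)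
congr (_ * _); have nB : n < (maxn M.+1 `|n|.+1)%:Z by lia.
rewrite (iter_nabla_conv _ _ (R0 u (k u) uS) nB).
rewrite [RHS](@sum_nat_widen t M.+1) ?leq_maxl // => i Mi.
apply/eqP; apply: contraTT Mi => ti0; rewrite -ltnNge.
have := bx (upd k w i); rewrite wE mulf_neq0 // => /(_ isT w).
by rewrite /upd eqxx !inE eqxx => ->.
Qed.

Lemma boxed_strip : (forall x k, x \in S -> vanish_neg (R x k)) ->
  boxed (w |: S)%SET R -> boxed S (strip R w u).
Proof.
move=> R0 bx k; rewrite -weight_strip // => H x xS.
have [i Hi] : exists i : 'I_M.+1, weight (w |: S)%SET R (upd k w i) != 0.
  apply: contrapT => nex; move/negP: H; apply; apply/eqP/big1 => i _.
  by apply: contrapT => /eqP wi; apply: nex; exists i.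
have := bx _ Hi x; rewrite /upd neq_leaf // => -> //.
by rewrite inE xS orbT.
Qed.

End Step.
End Stripping.

(** * The increment of a rooted sum *)

(** The coordinate l_w of a point of the slice is y w - m w + k w, with k w a
    natural number: m is a shift that makes all the coordinates natural.  The
    argument of the factor of j is raised by one, by the last term of [alE],
    because this factor is the difference between two consecutive values. *)
Section Increment.
Variables (T : plumbing_tree).
Local Notation V := (vertex T).
Variables (v j : V) (a y z : V -> rat) (m : V -> nat) (al : V -> int) (M : nat).
Hypothesis z_gt0 : forall w, 0 < z w.
Hypothesis z_harm : forall w, w != v ->
  (euler w)%:~R * z w + \sum_(u | edge w u) z u = 0.
Hypothesis a_dom : forall w,
  (valency w)%:R - 1 <= - ((euler w)%:~R * a w + \sum_(u | edge w u) a u).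
Hypotheses (ay : forall w, a w <= y w) (ya : forall w, y w <= a w + 1)
  (av : a v = y v).
Hypothesis alE : forall w, (al w)%:~R
  = - ((euler w)%:~R * (y w - (m w)%:R) + \sum_(u | edge w u) (y u - (m u)%:R))
    + (w == j)%:R.

Definition gap (w : V) (k : nat) : rat := y w - (m w)%:R + k%:R - a w.
Definition slope (w : V) (k : nat) : rat := gap w k / z w.
Definition nceil (x : rat) : nat := `|Num.max (0%R : int) (Num.ceil x)|%N.
(** The first k at which l_c >= y_c and l_c - a_c >= q. *)
Definition threshold (c : V) (q : rat) : nat := (m c + nceil (q + a c - y c))%N.
Definition threshold_sum (S : {set V}) (w : V) (k : nat) : nat :=
  (\sum_(c | (c \notin S) && edge w c) threshold c (z c * slope w k))%N.
Definition in_range (w : V) (k : nat) : bool :=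
  if w == v then k == m v else (m w <= k)%N.

Lemma nceil_ge x : x <= (nceil x)%:R.
Proof.
rewrite /nceil; have := ceil_ge x; case: (leP (0 : int) (Num.ceil x)) => c0.
  by case: (Num.ceil x) c0.
by move/le_trans; apply; rewrite (ler_int _ _ 0) ltW.
Qed.

Lemma nceil_le x : -1 <= x -> (nceil x)%:R <= x + 1.
Proof.
move=> x1; rewrite /nceil; have := ceilB1_lt x;
  case: (leP (0 : int) (Num.ceil x)) => c0; last by rewrite /=; lra.
by case: (Num.ceil x) c0 => // n _; rewrite rmorphB /= => H; apply/ltW; rewrite -ltrBlDr.
Qed.

Lemma gapE w k : gap w k = z w * slope w k.
Proof. by rewrite /slope mulrC divfK // gt_eqF. Qed.

Lemma gap_ge0 w k : (m w <= k)%N -> 0 <= gap w k.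
Proof. by rewrite -(ler_nat rat) /gap; have := ay w; lra. Qed.

Lemma slope_ge0 w k : (m w <= k)%N -> 0 <= slope w k.
Proof. by move=> mk; rewrite divr_ge0 ?gap_ge0 // ltW. Qed.

Lemma threshold_ge c q k : (threshold c q <= k)%N -> q <= gap c k /\ (m c <= k)%N.
Proof.
move=> tk; split; last by apply: leq_trans tk; apply: leq_addr.
move: tk; rewrite -(ler_nat rat) /threshold natrD /gap.
by have := nceil_ge (q + a c - y c); lra.
Qed.

(** Rounding up overshoots by at most 1, also when the bound l_c >= y_c is the
    active one, since y_c <= a_c + 1. *)
Lemma gap_threshold c q : 0 <= q -> gap c (threshold c q) <= q + 1.
Proof.
move=> q0; rewrite /gap /threshold natrD.
by have := @nceil_le (q + a c - y c); have := ya c; lra.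
Qed.

Lemma valency_split w u : edge w u ->
  (valency w)%:R = 1 + \sum_(c : V | edge w c && (c != u)) 1 :> rat.
Proof.
move=> ewu; rewrite sumr_const -mulrS /valency; congr _%:R.
have -> : #|[pred c | edge w c]| = ((u \in [pred c | edge w c])
    + #|[predD1 [pred c | edge w c] & u]|)%N by exact: cardD1.
rewrite unfold_in /= ewu add1n; congr (_.+1); apply: eq_card => c.
by rewrite !inE andbC.
Qed.

(** The inequality behind the whole proof.  By [gap_threshold] each child costs at
    most 1 more than its share z c * slope of the harmonic function z, and the
    chamber condition on a supplies valency w - 1, the number of the children. *)
Lemma thresholds_le_height w u k k' : w != v -> edge w u ->
  (m w <= k)%N -> slope u k' <= slope w k ->
  (\sum_(c : V | edge w c && (c != u)) threshold c (z c * slope w k))%:Z + (w == j)%:Z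
    <= al w - euler w * k%:Z - k'%:Z.
Proof.
move=> wv ewu mk sl; rewrite -(ler_int rat).
rewrite !(rmorphD, rmorphB, rmorphM, rmorphN) /= alE.
have := z_harm wv; have := a_dom w; rewrite (valency_split ewu).
rewrite !(bigD1 u ewu) /=.
rewrite -[(Posz _)%:~R]/(_%:R) natr_sum.
set Sy := \sum_(i | edge w i && (i != u)) (y i - (m i)%:R).
have zu : z u * slope u k' <= z u * slope w k by rewrite ler_pM2l.
move: zu; rewrite -gapE {1}/gap => zu.
have : \sum_(c : V | edge w c && (c != u)) (threshold c (z c * slope w k))%:R
   <= \sum_(c : V | edge w c && (c != u)) (z c * slope w k + 1 - (y c - (m c)%:R) + a c).
  apply: ler_sum => c _.
  have q0 : 0 <= z c * slope w k by rewrite mulr_ge0 ?slope_ge0 // ltW.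
  by have := gap_threshold c q0; rewrite {1}/gap; lra.
rewrite !big_split /= sumrN -mulr_suml -/Sy; move: Sy => Sy.
move: (\sum_(_ | _) _) => S1; move: (\sum_(_ | _) _) => S3.
move: (\sum_(_ | _) _) => S4; move: (\sum_(_ | _) _) => S5.
have : gap w k = z w * slope w k by exact: gapE.
rewrite {1}/gap -[(Posz k)%:~R]/(k%:R) -[(Posz k')%:~R]/(k'%:R).
rewrite -[(Posz (w == j))%:~R]/((w == j)%:R).
move: (euler w)%:~R => e lw H1 H2 H3.
have -> : k%:R = z w * slope w k - y w + (m w)%:R + a w by lra.
have : (e * z w + (z u + S3)) * slope w k = 0 by rewrite H3 mul0r.
lra.
Qed.

Lemma thresholds_le_height_root : 
  (\sum_(c : V | edge v c) threshold c (z c * slope v (m v)))%:Z + (v == j)%:Z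
    <= al v - euler v * (m v)%:Z + 1.
Proof.
rewrite -(ler_int rat) !(rmorphD, rmorphB, rmorphM, rmorphN) /= alE.
have s0 : slope v (m v) = 0 by rewrite /slope /gap av subrK subrr mul0r.
rewrite s0 -[(Posz (\sum_(_ | _) _))%:~R]/(_%:R) natr_sum.
set Sy := \sum_(i | edge v i) (y i - (m i)%:R).
have : \sum_(c : V | edge v c) (threshold c (z c * 0))%:R
   <= \sum_(c : V | edge v c) (1 - (y c - (m c)%:R) + a c).
  apply: ler_sum => c _; have := @gap_threshold c 0 (lexx _).
  by rewrite mulr0 /gap; lra.
rewrite !big_split /= sumrN -/Sy sumr_const -[#|_|]/(valency v).
have := a_dom v; rewrite av.
rewrite -[(Posz (m v))%:~R]/((m v)%:R) -[(Posz (v == j))%:~R]/((v == j)%:R).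
lra.
Qed.

(** The flag f is the vertex that has absorbed j, at first j itself.  All the
    other sequences have final slope 1; that of f has final slope 0 and vanishes
    unless its gap is nonnegative, even positive once the flag has moved. *)
Record strip_inv (S : {set V}) (R : V -> nat -> int -> int) (f : V) : Prop :=
  StripInv {
    inv_root : v \in S;
    inv_flag : f \in S;
    inv_flag_root : j = v -> f = v;
    inv_neg : forall w k, vanish_neg (R w k);
    inv_fix : forall k n, k != m v -> R v k n = 0;
    inv_slope : forall w k n, w \in S -> in_range w k ->
      (threshold_sum S w k)%:Z + (w == j)%:Z <= n -> nabla (R w k) n = (w != f)%:Z;
    inv_value : forall n, j = v -> (threshold_sum S v (m v))%:Z <= n -> R v (m v) n = 1;
    inv_null : forall k n, R f k n != 0 ->
      in_range f k /\ (f != j -> 0 < gap f k) }.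

Section InvStep.
Variables (S : {set V}) (w u f : V) (R : V -> nat -> int -> int).
Hypotheses (wS : w \notin S) (uS : u \in S) (ewu : edge w u)
  (uniq_nbr : forall x, x \in S -> edge w x -> x = u) (wv : w != v)
  (iR : strip_inv (w |: S)%SET R f).

Lemma threshold_sum_strip x k : x \in S -> threshold_sum S x k
  = (threshold_sum (w |: S)%SET x k + (x == u) * threshold w (z w * slope x k))%N.
Proof.
move=> xS; rewrite /threshold_sum (bigID (pred1 w)) /= addnC; congr (_ + _)%N.
  by apply: eq_bigl => c; rewrite !inE negb_or; case: eqP; rewrite ?andbF ?andbT.
have exw := edge_leaf ewu uniq_nbr xS.
case: (x == u) exw => exw.
  rewrite (big_pred1 w) => [|c]; first by rewrite mul1n.
  by rewrite /=; case: eqP => [->|_]; rewrite ?exw ?wS ?andbF.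
rewrite big_pred0 => [|c]; first by rewrite mul0n.
by case: eqP => [->|_]; rewrite ?exw ?andbF.
Qed.

Lemma threshold_sum_leaf k : threshold_sum (w |: S)%SET w k
  = (\sum_(c : V | edge w c && (c != u)) threshold c (z c * slope w k))%N.
Proof.
apply: eq_bigl => c; rewrite !inE negb_or andbC; case ewc: (edge w c) => //=.
have -> : c != w by apply: contraTneq ewc => ->; rewrite edge_irr.
congr (~~ _); apply/idP/eqP => [cS|->//]; exact: uniq_nbr.
Qed.

Lemma leaf_step_slope k i : (m w <= i)%N -> slope u k <= slope w i ->
  leaf_step al R w k i = (w != f)%:Z.
Proof.
move=> mi sl; apply: (inv_slope iR); rewrite ?inE ?eqxx //.
  by rewrite /in_range (negbTE wv).
by rewrite threshold_sum_leaf; apply: thresholds_le_height.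
Qed.

Lemma leaf_step_threshold k i : (threshold w (z w * slope u k) <= i)%N ->
  leaf_step al R w k i = (w != f)%:Z.
Proof.
move=> /threshold_ge[]; rewrite gapE ler_pM2l // => sl mi.
exact: leaf_step_slope.
Qed.

(** The final value at the flagged vertex is 0, so a nonzero term needs a slope
    at u larger than the nonnegative one at w. *)
Lemma slope_lt_of_flag k i : f = w -> leaf_step al R w k i != 0 -> 0 < slope u k.
Proof.
move=> fw gi; have mi : (m w <= i)%N.
  apply: contraNT gi => mi; suff R0 n : R w i n = 0 by rewrite /leaf_step /nabla !R0.
  apply/eqP; apply: contraNT mi; rewrite -fw => /(inv_null iR)[].
  by rewrite /in_range fw (negbTE wv).
apply: le_lt_trans (slope_ge0 mi) _; rewrite ltNge; apply: contraNN gi => sl.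
by rewrite leaf_step_slope // fw eqxx.
Qed.

Lemma gap_gt0_in_range x k : 0 < gap x k -> (m x <= k)%N.
Proof.
rewrite /gap; have := ya x => yx lx.
rewrite -ltnS -(ltr_nat rat) -[k.+1]addn1 natrD.
by lra.
Qed.

Lemma strip_inv_step :
  strip_inv S (strip al R w u) (if f == w then u else f).
Proof.
have fS : f != w -> f \in S.
  by have := inv_flag iR; rewrite !inE => /orP[->|].
have sx x k n : x != u -> strip al R w u x k n = R x k n.
  by rewrite /strip => /negbTE->.
have su k : strip al R w u u k = conv (leaf_step al R w k) (R u k).
  by rewrite /strip eqxx.
have vS : v \in S by have := inv_root iR; rewrite !inE eq_sym (negbTE wv).
split=> //.
- by case: eqP => // /eqP /fS.
- by move=> jv; case: eqP (inv_flag_root iR jv) => // -> /eqP; rewrite (negbTE wv).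
- move=> x k; rewrite /strip; case: eqP => _; last exact: inv_neg iR _ _.
  by apply: conv_vanish; apply: inv_neg iR _ _.
- move=> k n kv; have [vu|vu] := eqVneq v u; last by rewrite sx // (inv_fix iR).
  by rewrite vu su conv0 // => n'; rewrite -vu (inv_fix iR).
- move=> x k n xS dx; rewrite threshold_sum_strip //;
  have [xu|xu] := eqVneq x u; last first.
    rewrite addn0 => dn; rewrite /strip (negbTE xu) (inv_slope iR) ?inE ?xS ?orbT //.
    congr (~~ _)%:Z; case: (altP (f =P w)) => // ->.
    by rewrite (negbTE xu) (neq_leaf wS xS).
  subst x; rewrite mul1n PoszD => dn; rewrite su.
  rewrite (@nabla_conv _ _ (u != f)%:Z (w != f)%:Z
     ((threshold_sum (w |: S)%SET u k)%:Z + (u == j)%:Z) _ (threshold w (z w *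
       slope u k))).
  + by rewrite (eq_sym w); case: (altP (f =P w)) => _; rewrite ?eqxx ?mul0r ?mul1r.
  + exact: inv_neg iR _ _.
  + by move=> n' dn'; apply: (inv_slope iR) dn'; rewrite ?inE ?uS ?orbT.
  + exact: leaf_step_threshold.
  + by rewrite addrAC.
- move=> n jv; have fv := inv_flag_root iR jv; rewrite threshold_sum_strip //.
  have [vu|vu] := eqVneq v u; last first.
    by rewrite addn0 sx // => dn; apply: (inv_value iR).
  rewrite -vu in su *; rewrite mul1n PoszD su => dn.
  apply: (@conv_const1 _ _ ((threshold_sum (w |: S)%SET v (m v))%:Z + 1) _
    (threshold w (z w * slope v (m v)))).
  + exact: inv_neg iR _ _.
  + by move=> n' dn'; rewrite (inv_value iR) //; lia.
  + by move=> i; rewrite vu => /leaf_step_threshold ->; rewrite fv wv.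
  + by lia.
- move=> k n; case: (altP (f =P w)) => fw.
    rewrite su => cn; have [i gi] := conv_neq0 cn.
    have lu : 0 < gap u k by rewrite gapE mulr_gt0 // (slope_lt_of_flag fw gi).
    split=> //; rewrite /in_range; have [uv|uv] := eqVneq u v;
      last exact: gap_gt0_in_range.
    apply: contraNT cn => km; apply/eqP/conv0 => n'.
    by rewrite uv (inv_fix iR) // -uv.
  have [fu|fu] := eqVneq f u; last by rewrite sx //; apply: (inv_null iR).
  rewrite fu su => cn; have [n' Rn'] : exists n', R u k n' != 0.
    apply: contrapT => nex; move/negP: cn; apply; apply/eqP/conv0 => n'.
    by apply: contrapT => /eqP Rn; apply: nex; exists n'.
  by rewrite -fu in Rn' *; apply: (inv_null iR) Rn'.
Qed.
End InvStep.

(** At the end only the root is left, and it carries the flag.  If j <> v the flag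
    has moved, but the gap at v is 0; if j = v the sequence is finally 1, and its
    argument is in the final range by [thresholds_le_height_root]. *)
Lemma sum_weight S : rooted v S -> forall R f, strip_inv S R f ->
  boxed al M S R ->
  \sum_(k : {ffun V -> 'I_M.+1} | supported S k) weight al S R (fun u => k u)
  = (j == v)%:Z.
Proof.
elim=> [|{}S w u rS IH wS uS ewu uniq_nbr] R f iR bx; last first.
  have vS : v \in S by have [] := rooted_connect rS.
  have wv : w != v by apply: contraNneq wS => ->.
  rewrite sum_box_peel //; last by move=> k k' kk; apply: weight_ext => x _; apply: kk.
  have neg x k : x \in S -> vanish_neg (R x k) by move=> _; apply: (inv_neg iR).
  under eq_bigr => k _ do rewrite (weight_strip wS uS ewu uniq_nbr _ neg bx).
  apply: IH (strip_inv_step wS uS ewu uniq_nbr wv iR) _.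
  exact: boxed_strip.
have fv : f = v by have := inv_flag iR; rewrite inE => /eqP.
rewrite sum_box_set1; last by move=> k k' kk; apply: weight_ext => x _; apply: kk.
have wE i : weight al [set v]%SET R (upd (fun=> 0%N) v i) = R v i (al v - euler v * i%:Z).
  rewrite /weight big_set1 /upd eqxx /height big_pred0 => [|x].
    rewrite eqxx subr0 /inner_deg eq_card0 // => x.
    by rewrite unfold_in /= inE; case: eqP => // ->; rewrite edge_irr.
  by rewrite inE; case: eqP => // ->; rewrite edge_irr.
under eq_bigr => i _ do rewrite wE.
have [jv|jv] := eqVneq j v; last first.
  apply: big1 => i _; apply/eqP; apply: contraT => Ri.
  have im : (i : nat) = m v.
    by apply/eqP; apply: contraNT Ri => im; rewrite (inv_fix iR).
  have := inv_null iR; rewrite fv => /(_ _ _ Ri)[_]; rewrite eq_sym jv => /(_ isT).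
  by rewrite im /gap av subrK subrr ltxx.
have Rv : R v (m v) (al v - euler v * (m v)%:Z) = 1.
  apply: (inv_value iR) => //; have := thresholds_le_height_root; rewrite jv eqxx.
  rewrite lerD2r; suff -> : threshold_sum [set v]%SET v (m v)
    = (\sum_(c : V | edge v c) threshold c (z c * slope v (m v)))%N by [].
  by apply: eq_bigl => c; rewrite inE; case: eqP => // ->; rewrite edge_irr.
have mM : (m v < M.+1)%N.
  have := bx (upd (fun=> 0%N) v (m v)); rewrite wE Rv => /(_ isT v).
  by rewrite inE eqxx /upd eqxx => ->.
rewrite (bigD1 (Ordinal mM)) //= Rv big1 ?addr0 // => i im.
by apply: (inv_fix iR).
Qed.

Variable J : {set V}.
Hypothesis jJ : (j == v) || (j \in J).

(** A forbidden value of a coordinate is encoded by the zero sequence; the factor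
    of j carries one more difference. *)
Definition start (w : V) (k : nat) (n : int) : int :=
  if (if w == v then k == m v else (w \in J) ==> (m w <= k)%N)
  then (if w == j then nabla ramp else ramp) n else 0.

Lemma start_inv : strip_inv [set: V]%SET start j.
Proof.
have d0 w k : threshold_sum [set: V]%SET w k = 0%N.
  by rewrite /threshold_sum big_pred0 // => c; rewrite inE.
have sv w k : in_range w k -> start w k = (if w == j then nabla ramp else ramp).
  rewrite /in_range /start; case: eqP => _; first by move=> ->.
  by move=> ->; rewrite implybT.
split; rewrite ?inE //.
- move=> w k n n0; rewrite /start; case: ifP => // _.
  by case: eqP => _; [apply: nabla_vanish => //|]; apply: ramp_vanish.
- by move=> k n /negbTE kv; rewrite /start eqxx kv.
- move=> w k n _ dk; rewrite d0 sv //; case: eqP => _ /= n0; last exact: nabla_ramp.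
  by rewrite {1}/nabla !nabla_ramp ?subrr //; lia.
- move=> n jv; rewrite d0 => n0; rewrite sv /in_range ?eqxx // jv eqxx.
  exact: nabla_ramp.
- move=> k n; rewrite eqxx; rewrite /start /in_range; case: ifP; last by rewrite eqxx.
  by case: eqP jJ => [->|_] //= ->.
Qed.
End Increment.

(** * The dual lattice *)

Section LatticeFacts.
Variable T : plumbing_tree.
Local Notation V := (vertex T).
Local Notation LQ := {ffun V -> rat}.
Local Notation L' := (dual_lattice T).

Lemma form_E (y : LQ) (w : V) :
  form y (E w) = (euler w)%:~R * y w + \sum_(u | edge w u) y u.
Proof.
rewrite formE (bigD1 w) //= /intersection eqxx mulrC; congr (_ + _).
rewrite [RHS]big_mkcond [RHS](bigD1 w) //= edge_irr add0r.
apply: eq_bigr => u /negbTE->; rewrite edge_sym.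
by case: (edge w u); rewrite ?mulr1 ?mulr0.
Qed.

Lemma form_sumE (y n : LQ) : form y n = \sum_w n w * form y (E w).
Proof.
rewrite {1}/form /iform exchange_big; apply: eq_bigr => w _ /=.
rewrite formE mulr_sumr; apply: eq_bigr => v _.
by rewrite mulrA [y v * _]mulrC.
Qed.

Lemma form_neg_eq0 (y : LQ) : 0 <= form y y -> y = 0.
Proof.
by move=> y0; apply/eqP; apply: contraTT y0 => /negative_definite; rewrite ltNge.
Qed.

(** Split y into positive and negative parts p and n.  The hypothesis gives
    (y, n) <= 0, and (p, n) >= 0 because the parts have disjoint supports; so
    (n, n) >= 0, and n = 0 by negative definiteness. *)
Lemma antinef_ge0 (y : LQ) :
  (forall u, y u < 0 -> form y (E u) <= 0) -> forall u, 0 <= y u.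
Proof.
move=> yle; pose n : LQ := [ffun u => if y u < 0 then - y u else 0].
pose p : LQ := [ffun u => if y u < 0 then 0 else y u].
have n0 u : 0 <= n u by rewrite ffunE; case: ltP => // /ltW; rewrite oppr_ge0.
have p0 u : 0 <= p u by rewrite ffunE; case: ltP.
have yn : form y n <= 0.
  rewrite form_sumE; apply: sumr_le0 => u _; rewrite ffunE.
  case: ifP => [yu|_]; last by rewrite mul0r.
  by rewrite mulNr oppr_le0 mulr_le0 ?yle // ltW.
have pn : 0 <= form p n.
  apply: sumr_ge0 => u _; apply: sumr_ge0 => w _; rewrite /intersection.
  have [<-|_] := eqVneq u w; last by rewrite !mulr_ge0 // ler0z ler0n.
  by rewrite !ffunE; case: ifP => _; rewrite ?mul0r ?mulr0 ?mul0r.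
have ypn : y = p - n.
  by apply/ffunP => u; rewrite !ffunE; case: ifP => _; rewrite ?sub0r ?opprK ?subr0.
have e : form y n = form p n - form n n.
  rewrite !form_sumE -sumrB; apply: eq_bigr => w _; rewrite -mulrBr !formE -sumrB ypn.
  by congr (_ * _); apply: eq_bigr => u _; rewrite !ffunE mulrBl.
have : n = 0 by apply: form_neg_eq0; lra.
move=> nE u; have := congr1 (fun q : LQ => q u) nE; rewrite !ffunE.
by case: ltP => // yu; lra.
Qed.

(** A zero coordinate would force those of the neighbours to vanish, and then,
    by connectedness, all of them. *)
Lemma Estar_gt0 (v w : V) : 0 < Estar v w.
Proof.
have ge0 u : 0 <= Estar v u.
  by apply: antinef_ge0 => {}u _; rewrite form_Estar oppr_le0.
rewrite lt_def ge0 andbT; apply/eqP => w0.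
have cl : closed (@edge T) [pred u | Estar v u == 0].
  apply: (intro_closed (sym_connect_sym (@edge_sym T))) => x u exu.
  rewrite !inE => /eqP x0; have := form_Estar v x; rewrite form_E x0 mulr0 add0r.
  move=> sE; have : \sum_(u0 | edge x u0) Estar v u0 = 0.
    apply/eqP; rewrite eq_le; apply/andP; split; last exact: sumr_ge0.
    by rewrite sE oppr_le0.
  by move/eqP; rewrite psumr_eq0 // => /allP/(_ u (mem_index_enum _)); rewrite exu.
have all0 u : Estar v u = 0.
  have := closed_connect cl (edge_connected w u); rewrite !inE w0 eqxx.
  by move/esym/eqP.
have := form_Estar v v; rewrite form_E all0 mulr0 big1 // eqxx addr0 => /eqP.
by rewrite eq_sym oppr_eq0 oner_eq0.
Qed.

(** The coordinates in the basis of the dual vectors, see [sum_dEstar_hat]. *)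
Definition hat (l : L') (w : V) : int := Num.floor (- form l (E w)).

Lemma hatE l w : (hat l w)%:~R = - form l (E w).
Proof. by apply: floorK; rewrite rpredN; have /forallP := dvalP l. Qed.

Lemma hat_form l w :
  (hat l w)%:~R = - ((euler w)%:~R * l w + \sum_(u | edge w u) l u).
Proof. by rewrite hatE form_E. Qed.

Lemma hatD x y w : hat (x + y) w = hat x w + hat y w.
Proof.
apply: (@intr_inj rat); rewrite rmorphD /= !hat_form.
rewrite -opprD addrACA -mulrDr -big_split /= ffunE; congr (- (_ + _)).
by apply: eq_bigr => u _; rewrite ffunE.
Qed.

Lemma hat0 w : hat 0 w = 0.
Proof. by apply: (addrI (hat 0 w)); rewrite -hatD !addr0. Qed.

Lemma hatN x w : hat (- x) w = - hat x w.
Proof. by apply: (addrI (hat x w)); rewrite -hatD !subrr hat0. Qed.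

Lemma hatMn x n w : hat (x *+ n) w = hat x w *+ n.
Proof. by elim: n => [|n IH]; rewrite ?hat0 // !mulrSr hatD IH. Qed.

Lemma hatMz x (n : int) w : hat (x *~ n) w = hat x w * n.
Proof.
case: n => n; rewrite ?NegzE ?mulrNz ?hatN -?pmulrn hatMn ?mulrN;
 by rewrite -mulr_natr natz.
Qed.

Lemma hat_sum (I : Type) (r : seq I) (P : pred I) (F : I -> L') w :
  hat (\sum_(i <- r | P i) F i) w = \sum_(i <- r | P i) hat (F i) w.
Proof. by apply: (big_morph (hat^~ w)) => [x y|]; [exact: hatD|exact: hat0]. Qed.

Lemma hat_dEstar v w : hat (dEstar v) w = (v == w)%:Z.
Proof. by apply: (@intr_inj rat); rewrite hatE form_Estar opprK. Qed.

Lemma hat_inj x y : (forall w, hat x w = hat y w) -> x = y.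
Proof.
move=> xy; apply/eqP; rewrite -subr_eq0; apply/eqP/val_inj/form_neg_eq0.
rewrite form_sumE big1 // => w _; rewrite -[form _ _]opprK -hatE hatD hatN xy subrr.
by rewrite oppr0 mulr0.
Qed.

Lemma hat_sum_dEstar (n : V -> int) w : hat (\sum_v dEstar v *~ n v) w = n w.
Proof.
rewrite hat_sum (bigD1 w) //= hatMz hat_dEstar eqxx mul1r big1 ?addr0 // => v vw.
by rewrite hatMz hat_dEstar (negbTE vw) mul0r.
Qed.

Lemma sum_dEstar_hat x : \sum_v dEstar v *~ hat x v = x.
Proof. by apply: hat_inj => w; rewrite hat_sum_dEstar. Qed.

Lemma dvalD (x y : L') w : (x + y) w = x w + y w. Proof. by rewrite ffunE. Qed.
Lemma dvalB (x y : L') w : (x - y) w = x w - y w. Proof. by rewrite !ffunE. Qed.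
Lemma dvalMn (x : L') n w : (x *+ n) w = x w *+ n.
Proof. by elim: n => [|n IH]; rewrite ?mulrSr ?dvalD ?IH // ffunE. Qed.
Lemma dvalMz (x : L') (n : int) w : (x *~ n) w = x w * n%:~R.
Proof.
by case: n => n; rewrite ?NegzE ?mulrNz ?ffunE -?pmulrn dvalMn ?mulrN -mulr_natr.
Qed.
Lemma dval_sum (I : Type) (r : seq I) (P : pred I) (F : I -> L') w :
  (\sum_(i <- r | P i) F i) w = \sum_(i <- r | P i) F i w.
Proof. by apply: (big_morph (fun x : L' => x w)) => [x y|]; rewrite ffunE. Qed.

Lemma dval_hat (x : L') w : x w = \sum_v (hat x v)%:~R * Estar v w.
Proof.
rewrite -{1}[x]sum_dEstar_hat dval_sum; apply: eq_bigr => v _.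
by rewrite dvalMz mulrC.
Qed.

Lemma E_dual v : E v \in @in_dual T.
Proof.
apply/forallP => w; rewrite form_E; apply: rpredD.
  by rewrite rpredM ?intr_int // ffunE rpred_nat.
by apply: rpred_sum => u _; rewrite ffunE rpred_nat.
Qed.
Definition dE v : L' := DualLattice (E_dual v).

Lemma in_L_dE v : dE v \in @in_L T.
Proof. by apply/forallP => w; rewrite ffunE rpred_nat. Qed.

Lemma clsE x y : (cls x == cls y) = (x - y \in @in_L T).
Proof. by rewrite /cls Quotient.idealrBE. Qed.

Lemma dE_sum (k : V -> int) w : (\sum_v dE v *~ k v) w = (k w)%:~R.
Proof.
rewrite dval_sum (bigD1 w) //= dvalMz ffunE eqxx mul1r big1 ?addr0 // => v vw.
by rewrite dvalMz ffunE eq_sym (negbTE vw) mul0r.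
Qed.

(** All the dual vectors have positive coordinates, so one coordinate of a
    nonnegative combination bounds all its coefficients.  The bound -1 instead
    of 0 leaves room for the translation by a dual vector. *)
Lemma lattice_bounded v (c : rat) : exists C : nat, forall l : L',
  (forall w, -1 <= hat l w) -> l v <= c -> forall u, `|l u| <= C%:R.
Proof.
pose s (u : V) : rat := \sum_(w : V) Estar w u.
have s0 u : 0 <= s u by apply: sumr_ge0 => w _; apply/ltW/Estar_gt0.
pose C1 : rat := \sum_(w : V) \sum_(u : V) ((`|c| + s v) / Estar w v * Estar w u).
pose C : rat := C1 + \sum_u s u.
have C10 u : 0 <= \sum_w ((`|c| + s v) / Estar w v * Estar w u).
  apply: sumr_ge0 => w _; apply: mulr_ge0; last by rewrite ltW ?Estar_gt0.
  by apply: divr_ge0; [apply: addr_ge0|rewrite ltW ?Estar_gt0].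
exists (Num.truncn C).+1 => l lh lc u.
have lplus x : l x + s x = \sum_w (hat l w + 1)%:~R * Estar w x.
  rewrite (dval_hat l x) -big_split /=; apply: eq_bigr => w _.
  by rewrite rmorphD /= mulrDl mul1r.
have h0 w : 0 <= (hat l w + 1)%:~R :> rat by rewrite ler0z; have := lh w; lia.
have term0 x w : 0 <= (hat l w + 1)%:~R * Estar w x.
  by rewrite mulr_ge0 // ltW ?Estar_gt0.
have hb w : (hat l w + 1)%:~R <= (`|c| + s v) / Estar w v.
  rewrite ler_pdivlMr ?Estar_gt0 //; apply: (@le_trans _ _ (l v + s v)).
    by rewrite lplus (bigD1 w) //= lerDl sumr_ge0.
  by rewrite lerD2r; apply: le_trans lc (ler_norm c).
have lu : l u + s u <= \sum_w ((`|c| + s v) / Estar w v * Estar w u).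
  by rewrite lplus; apply: ler_sum => w _; rewrite ler_pM2r ?Estar_gt0.
have lu0 : 0 <= l u + s u by rewrite lplus sumr_ge0.
have CC : C1 + \sum_u s u <= (Num.truncn C).+1%:R by apply/ltW/truncnS_gt.
apply: le_trans CC; have : s u <= \sum_u s u by rewrite (bigD1 u) //= lerDl sumr_ge0.
have : \sum_w ((`|c| + s v) / Estar w v * Estar w u) <= C1.
  by rewrite /C1 exchange_big [leRHS](bigD1 u) //= lerDl sumr_ge0.
by move=> H1 H2; rewrite ler_norml; apply/andP; split; have := C10 u; have := s0 u; lra.
Qed.

End LatticeFacts.

(** * Sums over slices of the dual lattice *)

Section FiniteSupport.
Variable L : zmodType.

Definition total (F : L -> int) : int := \sum_(l \in [set: L]%classic) F l.

Definition finsupp (F : L -> int) : Prop :=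
  exists r : seq L, forall l, F l != 0 -> l \in r.

Lemma total_seq F (r : seq L) : uniq r -> (forall l, F l != 0 -> l \in r) ->
  total F = \sum_(l <- r) F l.
Proof.
move=> ur Fr; rewrite /total (fsbigE r) //; last first.
  by move=> l _; apply: contraNeq => /Fr.
by apply: eq_bigl => l; rewrite in_setT.
Qed.

Lemma eq_total F G : F =1 G -> total F = total G.
Proof. by move=> FG; congr total; apply: funext. Qed.

Lemma totalB F G : finsupp F -> finsupp G ->
  total (fun l => F l - G l) = total F - total G.
Proof.
move=> [r Fr] [s Gs]; have ur := undup_uniq (r ++ s).
rewrite !(total_seq ur) ?sumrB // => l; rewrite mem_undup mem_cat.
- by move/Gs->; rewrite orbT.
- by move/Fr->.
- by case: (eqVneq (F l) 0) => [->|/Fr-> //]; rewrite sub0r oppr_eq0 => /Gs->;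
  rewrite orbT.
Qed.

Lemma total_shift F (d : L) : total (fun l => F (l + d)) = total F.
Proof.
rewrite /total [RHS](reindex_fsbigT (fun l => l + d)) //.
by exists (fun l => l - d) => l; rewrite ?addrK ?subrK.
Qed.

Lemma total_image (I : finType) (i : I -> L) F : injective i ->
  (forall l, F l != 0 -> exists k, l = i k) -> total F = \sum_k F (i k).
Proof.
move=> inj Fi; rewrite (@total_seq _ [seq i k | k <- enum I]).
- by rewrite big_map enumT.
- by rewrite map_inj_uniq ?enum_uniq.
- by move=> l /Fi[k ->]; apply: map_f; rewrite mem_enum.
Qed.

End FiniteSupport.

Section Slices.
Variable T : plumbing_tree.
Local Notation V := (vertex T).
Local Notation L' := (dual_lattice T).

Definition vertex_coef (w : V) : int -> int := iter (valency w) nabla ramp.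

Definition tree_coef (l : L') : int := \prod_w vertex_coef w (hat l w).

Lemma vertex_coef_neg w : vanish_neg (vertex_coef w).
Proof. exact/iter_nabla_vanish/ramp_vanish. Qed.

Lemma tree_coef_hat_ge0 l : tree_coef l != 0 -> forall w, 0 <= hat l w.
Proof.
move=> pl w; rewrite leNgt; apply: contraNN pl => hw; rewrite /tree_coef (bigD1 w) //=.
by rewrite vertex_coef_neg ?mul0r.
Qed.

Definition slice (J : {set V}) (v : V) (y l : L') : bool :=
  [&& l - y \in @in_L T, [forall w in J, y w <= l w] & l v == y v].

Definition slice_sum (J : {set V}) (v : V) (y : L') : int :=
  total (fun l => if slice J v y l then tree_coef l else 0).

(** The points of the class of y, with the corner of the box at y - (m, .., m). *)
Definition box_point (y : L') (m : nat) (k : V -> nat) : L' :=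
  y + \sum_w dE w *~ ((k w)%:Z - m%:Z).

Lemma box_point_coord y m k w : box_point y m k w = y w - m%:R + (k w)%:R.
Proof.
rewrite /box_point dvalD dE_sum rmorphB /= -[(Posz (k w))%:~R]/((k w)%:R).
by rewrite -[(Posz m)%:~R]/(m%:R); ring.
Qed.

Lemma box_point_in_L y m k : box_point y m k - y \in @in_L T.
Proof.
rewrite /box_point addrC addKr; apply: rpred_sum => w _; apply: rpredMz.
exact: in_L_dE.
Qed.

Lemma box_point_inj y m k k' : box_point y m k = box_point y m k' -> k =1 k'.
Proof.
move=> e w; have := congr1 (fun l : L' => l w) e; rewrite !box_point_coord.
by move/addrI/eqP; rewrite eqr_nat => /eqP.
Qed.

Lemma in_box y (m C : nat) l : l - y \in @in_L T ->
  (forall u, `|l u| <= C%:R) -> (forall u, C%:R + `|y u| <= m%:R) ->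
  exists k : {ffun V -> 'I_(m + m).+1}, l = box_point y m (fun u => k u).
Proof.
move=> /forallP lL lC yC.
have kint u : exists k : 'I_(m + m).+1, l u = y u - m%:R + (k : nat)%:R.
  have /intrP[k kE] := lL u; rewrite dvalB in kE.
  have := lC u; have := yC u; rewrite ler_norml => H /andP[H1 H2].
  have := ler_norm (y u); have := ler_norm (- y u); rewrite normrN => H3 H4.
  have k1 : - m%:R <= k%:~R :> rat by lra.
  have k2 : k%:~R <= m%:R :> rat by lra.
  have km : - m%:Z <= k by rewrite -(ler_int rat) rmorphN.
  have mk : k <= m%:Z by rewrite -(ler_int rat).
  have b : (absz (k + m%:Z)%R < (m + m).+1)%N by lia.
  exists (Ordinal b); rewrite [nat_of_ord _]/=;
    have -> : (absz (k + m%:Z))%:R = k%:~R + m%:R :> rat.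
    by rewrite -[LHS]/((Posz (absz (k + m%:Z)))%:~R) gez0_abs ?rmorphD //; lia.
  by lra.
have [k kE] := choice kint; exists [ffun u => k u].
by apply/val_inj/ffunP => u; rewrite [RHS]box_point_coord ffunE kE.
Qed.

Lemma box_bound y (C : nat) : exists m : nat, forall u : V, C%:R + `|y u : rat| <= m%:R.
Proof.
exists (\sum_(u : V) (Num.truncn (C%:R + `|y u|)).+1)%N => u.
rewrite natr_sum (bigD1 u) //=; apply: (@le_trans _ _ (Num.truncn (C%:R + `|y u|)).+1%:R).
  by apply/ltW/truncnS_gt.
by rewrite lerDl sumr_ge0.
Qed.

Lemma bounded_finsupp y (C : nat) (F : L' -> int) :
  (forall l, F l != 0 ->
     l - y \in @in_L T /\ forall u, `|l u| <= C%:R) -> finsupp F.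
Proof.
move=> FC; have [m mC] := box_bound y C.
exists [seq box_point y m (fun u => (k : {ffun V -> 'I_(m + m).+1}) u)
       | k <- enum {: {ffun V -> 'I_(m + m).+1}}] => l /FC[lL lC].
have [k ->] := in_box lL lC mC.
by apply/mapP; exists k; rewrite ?mem_enum.
Qed.

Lemma slice_finsupp J v y (F : L' -> int) :
  (forall l w, F l != 0 -> -1 <= hat l w) ->
  finsupp (fun l => if slice J v y l then F l else 0).
Proof.
move=> Fh; have [C bC] := lattice_bounded v (y v).
apply: (@bounded_finsupp y C) => l.
case: ifP => [/and3P[lL _ /eqP lv] Fl|]; last by rewrite eqxx.
by split=> //; apply: bC => [w|]; [apply: Fh|rewrite lv].
Qed.

Lemma hat_box_point y m k w : hat (box_point y m k) w
  = hat (box_point y m (fun=> 0%N)) w - euler w * (k w)%:Z - \sum_(u | edge w u) (k u)%:Z.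
Proof.
apply: (@intr_inj rat); rewrite !(rmorphB, rmorphM) /= !hat_form rmorph_sum /=.
rewrite !box_point_coord addr0.
under eq_bigr => u _ do rewrite box_point_coord.
under [in RHS]eq_bigr => u _ do rewrite box_point_coord addr0.
rewrite big_split /= -[(Posz (k w))%:~R]/((k w)%:R).
by ring.
Qed.

Lemma hat_ge_of_tree_coef l d w : tree_coef (l + dEstar d) != 0 -> -1 <= hat l w.
Proof.
by move=> /tree_coef_hat_ge0/(_ w); rewrite hatD hat_dEstar; case: (_ == _); lia.
Qed.

Lemma sliceD J v y l d : slice J v (y + d) (l + d) = slice J v y l.
Proof.
rewrite /slice opprD addrACA subrr addr0 !dvalD (inj_eq (addIr _)).
by congr [&& _, _ & _]; apply: eq_forallb => w; rewrite !dvalD lerD2r.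
Qed.

Lemma weight_start (J : {set V}) v j y m k : (j == v) || (j \in J) ->
  weight (fun w => hat (box_point y m (fun=> 0%N)) w + (w == j)%:Z) [set: V]%SET
    (start v j (fun=> m) J) k
  = if slice J v y (box_point y m k)
    then tree_coef (box_point y m k + dEstar j) - tree_coef (box_point y m k) else 0.
Proof.
move=> jJ.
have cnt w : (y w <= box_point y m k w) = (m <= k w)%N.
  by rewrite box_point_coord -addrA lerDl addrC subr_ge0 ler_nat.
have cond : slice J v y (box_point y m k) =
    [forall w, if w == v then k w == m else (w \in J) ==> (m <= k w)%N].
  rewrite /slice box_point_in_L /= box_point_coord -addrA -[eqbRHS]addr0 (inj_eq
    (addrI _)).
  rewrite addrC subr_eq0 eqr_nat; apply/andP/forallP => [[/forallP H kv] w|H].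
    by case: eqP => [->//|_]; have := H w; rewrite cnt.
  have kv := H v; rewrite eqxx in kv; split=> //; apply/forallP => w.
  by rewrite cnt; have := H w; case: eqP => [->|//]; rewrite (eqP kv) leqnn implybT.
have degE w : inner_deg [set: V]%SET w = valency w.
  by apply: eq_card => u; rewrite !inE.
have heightE w : height (fun w => hat (box_point y m (fun=> 0%N)) w + (w ==
  j)%:Z) [set: V]%SET k w
    = hat (box_point y m k) w + (w == j)%:Z.
  rewrite /height (hat_box_point y m k) (eq_bigl (fun u => edge w u)); first by ring.
  by move=> u; rewrite inE.
rewrite cond; case: forallP => H; last first.
  have [w Hw] : exists w, ~~ (if w == v then k w == m else (w \in J) ==> (m <= k w)%N).
    by apply: contrapT => nex; apply: H => w; apply: contrapT => /negP Hw;
      apply: nex; exists w.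
  rewrite /weight (bigD1 w) ?inE //=;
    suff it n h : iter n nabla (start v j (fun=> m) J w (k w)) h = 0.
    by rewrite it mul0r.
  elim: n h => [|n IH] h /=; last by rewrite /nabla !IH subrr.
  by rewrite /start (negbTE Hw).
have st w : start v j (fun=> m) J w (k w) = if w == j then nabla ramp else ramp.
  by apply: funext => n; rewrite /start H.
rewrite /weight (bigD1 j) ?inE //= st degE heightE eqxx -iterSr.
have pcE l : tree_coef l = vertex_coef j (hat l j) * \prod_(i | i != j)
  vertex_coef i (hat l i).
  by rewrite /tree_coef (bigD1 j).
rewrite !pcE.
rewrite hatD hat_dEstar eqxx.
have -> : \prod_(i | i != j) vertex_coef i (hat (box_point y m k + dEstar j) i)
   = \prod_(i | i != j) vertex_coef i (hat (box_point y m k) i).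
  by apply: eq_bigr => i ij; rewrite hatD hat_dEstar eq_sym (negbTE ij) addr0.
rewrite -mulrBl; congr (_ * _).
  by rewrite iter_nablaS /vertex_coef addrK.
apply: eq_big => [w|w]; first by rewrite inE.
by move=> /andP[_ /negbTE wj]; rewrite degE heightE st wj addr0.
Qed.

(** The two slice sums run over the same points l, once with the coefficient of
    l + Estar j and once with that of l; their difference is the rooted sum of
    [sum_weight]. *)
Lemma slice_sum_increment (J : {set V}) (v j : V) (y : L') (av : V -> rat) :
  (j == v) || (j \in J) ->
  (forall w, (valency w)%:R - 1
     <= - ((euler w)%:~R * av w + \sum_(u | edge w u) av u)) ->
  (forall w, av w <= y w) -> (forall w, y w <= av w + 1) -> av v = y v ->
  slice_sum J v (y + dEstar j) = slice_sum J v y + (j == v)%:Z.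
Proof.
move=> jJ a_dom ay ya avy; apply/eqP; rewrite [eqbRHS]addrC -subr_eq; apply/eqP.
pose F (l : L') := if slice J v y l then tree_coef (l + dEstar j) else 0.
pose G (l : L') := if slice J v y l then tree_coef l else 0.
have fF : finsupp F.
  by apply: slice_finsupp => l w; apply: hat_ge_of_tree_coef.
have fG : finsupp G.
  by apply: slice_finsupp => l w /tree_coef_hat_ge0 /(_ w); lia.
have -> : slice_sum J v (y + dEstar j) = total F.
  by rewrite /slice_sum -(total_shift _ (dEstar j)); apply: eq_total => l; rewrite sliceD.
rewrite -[slice_sum J v y]/(total G) -totalB //.
(* Both slices fit in one box around y. *)
have [C bC] := lattice_bounded v (y v).
have [m mC] := box_bound y C.
have FGh l : F l - G l != 0 -> slice J v y l /\ forall w, -1 <= hat l w.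
  rewrite /F /G; case: ifP => [sl|]; last by rewrite subrr eqxx.
  move=> FG; split=> // w; case: (eqVneq (tree_coef (l + dEstar j)) 0) => [p0|];
    last exact: hat_ge_of_tree_coef.
  by move: FG; rewrite p0 sub0r oppr_eq0 => /tree_coef_hat_ge0 /(_ w); lia.
pose i (k : {ffun V -> 'I_(m + m).+1}) := box_point y m (fun u => k u).
have inj : injective i.
  by move=> k k' /box_point_inj kk; apply/ffunP => u; apply/val_inj; exact: kk.
rewrite (total_image inj) => [|l /FGh[/and3P[lL _ /eqP lv] lh]]; last first.
  by apply: in_box lL (bC l lh _) mC; rewrite lv.
pose al w := hat (box_point y m (fun=> 0%N)) w + (w == j)%:Z.
pose R := start v j (fun=> m) J.
have wE k : weight al [set: V]%SET R k = F (box_point y m k) - G (box_point y m k).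
  by rewrite weight_start // /F /G; case: ifP => // _; rewrite subrr.
rewrite -[RHS](@sum_weight T v j av y (Estar v) (fun=> m) al (m + m) _ _ _ _ _ _
  _ [set: V]%SET (rootedT v) R j).
- by rewrite sum_box_setT; apply: eq_bigr => k _; rewrite wE.
- exact: Estar_gt0.
- move=> w wv; rewrite -form_E form_Estar eq_sym (negbTE wv) oppr0 //.
- exact: a_dom.
- exact: ay.
- exact: ya.
- exact: avy.
- move=> w; rewrite /al rmorphD /= hat_form; congr (- (_ * _ + _) + _).
    by rewrite box_point_coord addr0.
  by apply: eq_bigr => u _; rewrite box_point_coord addr0.
- exact: start_inv.
- move=> k; rewrite wE => /FGh[sl lh] x _; have := bC _ lh _ x; have := mC x.
  case/and3P: sl => _ _ /eqP ->; rewrite lexx box_point_coord => mCx /(_ isT).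
  rewrite ler_norml => /andP[_ kx]; have := ler_norm (- y x); rewrite normrN => nx.
  rewrite ltnS -(ler_nat rat) natrD; lra.
Qed.

End Slices.

(** * Counting functions along a segment *)

Section Counting.
Variable T : plumbing_tree.
Local Notation V := (vertex T).
Local Notation LQ := {ffun V -> rat}.
Local Notation L' := (dual_lattice T).
Local Notation H := (discr T).

(** The common form of the counting functions and of the equivariant parts of
    C_H. *)
Definition count_below (h : H) (J : {set V}) (x : L') : int :=
  total (fun l => if (cls l == h) && [exists i in J, l i < x i] then tree_coef l else 0).

Lemma eq_count_below h (J : {set V}) (x x' : L') :
  (forall l, cls l = h -> forall i, i \in J -> (l i < x i) = (l i < x' i)) ->
  count_below h J x = count_below h J x'.
Proof.
move=> xx; apply: eq_total => l; case: eqP => //= lh.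
suff -> : [exists i in J, l i < x i] = [exists i in J, l i < x' i] by [].
by apply: eq_existsb => i; case: (boolP (i \in J)) => //= iJ; apply: xx.
Qed.

Lemma below_finsupp (y : L') (J : {set V}) (x : L') :
  finsupp (fun l => if (cls l == cls y) && [exists i in J, l i < x i] then
    tree_coef l else 0).
Proof.
have fi i : finsupp (fun l =>
    if (cls l == cls y) && (l i < x i) then tree_coef l else 0).
  have [C bC] := lattice_bounded i (x i).
  apply: (@bounded_finsupp _ y C) => l; case: ifP => [|]; last by rewrite eqxx.
  rewrite clsE => /andP[lL /ltW li] /tree_coef_hat_ge0 lh; split=> //.
  by apply: bC => // w; have := lh w; lia.
have [r rP] := choice fi.
exists (flatten [seq r i | i <- enum V]) => l.
case: ifP => [/andP[lc /existsP[i /andP[_ li]]] pl|]; last by rewrite eqxx.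
apply/flatten_mapP; exists i; rewrite ?mem_enum //.
by apply: rP; rewrite lc li.
Qed.

Lemma slice_sum_ext (J : {set V}) v (y y' : L') : v \in J -> y' - y \in @in_L T ->
  (forall i, i \in J -> y' i = y i) -> slice_sum J v y' = slice_sum J v y.
Proof.
move=> vJ yL yJ; apply: eq_total => l; rewrite /slice yJ //.
have -> : (l - y' \in @in_L T) = (l - y \in @in_L T).
  have -> : l - y' = (l - y) - (y' - y) by rewrite opprB addrA subrK.
  by rewrite rpredBr.
suff -> : [forall w in J, y' w <= l w] = [forall w in J, y w <= l w] by [].
by apply: eq_forallb => w; case: (boolP (w \in J)) => //= wJ; rewrite yJ.
Qed.

(** The new points satisfy y_v <= l_v < y_v + 1 with l_v congruent to y_v modulo
    1, so l_v = y_v. *)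
Lemma count_below_step (J : {set V}) v y : v \in J ->
  count_below (cls y) J (y + dE v) = count_below (cls y) J y + slice_sum J v y.
Proof.
move=> vJ; apply/eqP; rewrite [eqbRHS]addrC -subr_eq; apply/eqP.
rewrite -totalB; try exact: below_finsupp.
apply: eq_total => l; rewrite clsE /slice; case: (boolP (_ \in @in_L T)) => lL;
  rewrite ?andTb ?andFb; last by rewrite subrr.
have [k kE] : exists k : int, l v = y v + k%:~R.
  by have /forallP/(_ v)/intrP[k kE] := lL; exists k; rewrite -kE dvalB addrC subrK.
case: (boolP [exists i in J, l i < y i]) => [/existsP[i /andP[iJ li]]|nex].
  have -> : [exists i in J, l i < (y + dE v) i].
    apply/existsP; exists i; rewrite iJ (lt_le_trans li) // dvalD lerDl ffunE.
    by case: (_ == _).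
  have -> : [forall w in J, y w <= l w] = false.
    by apply/negP => /forallP/(_ i); rewrite iJ leNgt li.
  by rewrite subrr.
have yl w : w \in J -> y w <= l w.
  by move=> wJ; rewrite leNgt; apply: contraNN nex => lw; apply/existsP;
    exists w; rewrite wJ.
have -> : [forall w in J, y w <= l w] by apply/forallP => w; apply/implyP/yl.
rewrite subr0 /=; suff -> : [exists i in J, l i < (y + dE v) i] = (l v == y v) by [].
apply/existsP/eqP => [[i /andP[iJ]]|lv].
  rewrite dvalD ffunE; have [->|_] := eqVneq i v; last by rewrite addr0 ltNge yl.
  have := yl v vJ; rewrite kE lerDl ltrD2l ler0z (ltr_int _ _ 1) => k0 k1.
  by have -> : k = 0 by [lia|]; rewrite addr0.
by exists v; rewrite vJ dvalD ffunE eqxx lv ltrDl.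
Qed.

(** The hypotheses of [slice_sum_increment]: y is obtained by rounding up a point
    a of the chamber whose coordinate at v is already y v. *)
Definition admissible_point (v : V) (y : L') : Prop := exists a : V -> rat,
  [/\ forall w, (valency w)%:R - 1
        <= - ((euler w)%:~R * a w + \sum_(u | edge w u) a u),
      forall w, a w <= y w, forall w, y w <= a w + 1 & a v = y v].

Lemma admissibleD v y d : admissible_point v y -> (forall w, 0 <= hat d w) ->
  admissible_point v (y + d).
Proof.
move=> [a [dom ay ya av]] hd; exists (fun w => a w + d w); split=> [w|w|w|].
- have := dom w; have : 0 <= (hat d w)%:~R :> rat by rewrite ler0z.
  rewrite hat_form big_split /= => H1 H2; lra.
- by rewrite dvalD lerD2r.
- by rewrite dvalD addrAC lerD2r.
- by rewrite dvalD av.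
Qed.

Lemma slice_sum_incrMn (J : {set V}) v j y n : (j == v) || (j \in J) ->
  admissible_point v y ->
  slice_sum J v (y + dEstar j *+ n) = slice_sum J v y + (n * (j == v))%N%:Z.
Proof.
move=> jJ adm; elim: n => [|n IH]; first by rewrite mulr0n !addr0.
have hd w : 0 <= hat (dEstar j *+ n) w.
  by rewrite hatMn hat_dEstar mulrn_wge0.
have [a [dom ay ya av]] := admissibleD adm hd.
rewrite mulrSr addrA (slice_sum_increment jJ dom ay ya av) IH.
by rewrite mulSn addnC PoszD addrA.
Qed.

Lemma slice_sum_shift (J : {set V}) v y d : v \in J -> admissible_point v y ->
  (forall w, 0 <= hat d w) -> (forall w, w \notin J -> hat d w = 0) ->
  slice_sum J v (y + d) = slice_sum J v y + hat d v.
Proof.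
move=> vJ adm hd dJ; pose part (r : seq V) := \sum_(j <- r) dEstar j *+ `|hat d j|%N.
have hpart r w : 0 <= hat (part r) w.
  rewrite hat_sum; apply: sumr_ge0 => j _.
  by rewrite hatMn hat_dEstar mulrn_wge0.
have H r : slice_sum J v (y + part r)
    = slice_sum J v y + \sum_(j <- r) (`|hat d j| * (j == v))%N%:Z.
  elim: r => [|j r IH]; first by rewrite /part !big_nil !addr0.
  rewrite /part !big_cons [_ + \sum_(_ <- _) _]addrC addrA.
  case: (boolP (j \in J)) => jJ; last first.
    by rewrite dJ // mulr0n addr0 mul0n add0r.
  rewrite slice_sum_incrMn ?jJ ?orbT //; last exact: (admissibleD adm (hpart r)).
  by rewrite -/(part r) IH -addrA; congr (_ + _); rewrite addrC.
have dE : d = part (index_enum V).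
  apply: hat_inj => w; rewrite hat_sum (bigD1 w) //= hatMn hat_dEstar eqxx.
  rewrite big1 ?addr0 => [|j /negbTE jw]; last by rewrite hatMn hat_dEstar jw mul0rn.
  by rewrite natz gez0_abs.
rewrite {1}dE H; congr (_ + _); rewrite (bigD1 v) //= eqxx muln1 gez0_abs //.
by rewrite big1 ?addr0 // => j /negbTE->; rewrite muln0.
Qed.

(** The translation lam is replaced by d, which has the same coordinates on J but
    only nonnegative pairings, all zero off J; the points of the path from y to
    y + \sum_w mu w E_w are y + \sum_w K w E_w. *)
Section Path.
Variables (J : {set V}) (x y lam d : L') (mu : V -> nat).
Hypotheses (x_dom : forall w, (valency w)%:Z - 1 <= hat x w)
  (xy : forall w, x w <= y w) (yx : forall w, y w <= x w + 1)
  (mu_gt0 : forall w, (0 < mu w)%N).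
Let walk (K : V -> nat) : L' := y + \sum_w dE w *+ K w.
Hypothesis hat_mu : forall w, 0 <= hat (\sum_w dE w *+ mu w) w.
Hypotheses (lamL : lam \in @in_L T) (lam_d : lam - d \in @in_L T)
  (lamJ : forall i, i \in J -> lam i = d i)
  (d_ge0 : forall w, 0 <= hat d w) (dJ : forall w, w \notin J -> hat d w = 0).

Lemma walk_coord K w : walk K w = y w + (K w)%:R.
Proof.
rewrite /walk dvalD dval_sum (bigD1 w) //= dvalMn ffunE eqxx big1 ?addr0 // => u uw.
by rewrite dvalMn ffunE eq_sym (negbTE uw) mul0rn.
Qed.

Lemma cls_walk K : cls (walk K) = cls y.
Proof.
apply/eqP; rewrite clsE /walk addrC addKr; apply: rpred_sum => w _.
by apply: rpredMn; apply: in_L_dE.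
Qed.

Definition on_path (K : {ffun V -> nat}) : Prop :=
  (forall w, (K w <= mu w)%N) /\
  exists t : rat, [/\ 0 <= t, t <= 1 &
    forall w, 0 <= y w + (K w)%:R - (x w + t * (mu w)%:R) <= 1].

Definition bumped (K : {ffun V -> nat}) v : {ffun V -> nat} :=
  [ffun w => (K w + (w == v))%N].

(** Move along the segment from x until it meets the next hyperplane l_v =
    constant at which the rounding jumps.  All the other coordinates are still
    within distance 1 there. *)
Lemma path_step K : on_path K -> (exists w, K w != mu w) ->
  exists v, [/\ (K v < mu v)%N, on_path (bumped K v)
              & admissible_point v (walk K)].
Proof.
move=> [Kmu [t [t0 t1 tK]]] [w0 Kw0].
have w0lt : (K w0 < mu w0)%N by rewrite ltn_neqAle Kw0 Kmu.
(* [tau w] is the time at which the rounded coordinate w makes its next jump. *)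
pose tau w : rat := (y w + (K w)%:R - x w) / (mu w)%:R.
have mu0 w : 0 < (mu w)%:R :> rat by rewrite ltr0n.
have tauE w : tau w * (mu w)%:R = y w + (K w)%:R - x w by rewrite divfK // gt_eqF.
have [v Kv tmin] := @arg_minP _ _ _ w0 (fun w => (K w < mu w)%N) tau w0lt.
pose s := tau v.
have ts : t <= s.
  by rewrite /s /tau ler_pdivlMr //; have /andP[] := tK v; lra.
have s1 : s <= 1.
  rewrite /s /tau ler_pdivrMr // mul1r; have := yx v.
  by move: Kv; rewrite -(ler_nat rat) -natr1; lra.
have sK w : 0 <= y w + (K w)%:R - (x w + s * (mu w)%:R) <= 1.
  apply/andP; split; last first.
    have : t * (mu w)%:R <= s * (mu w)%:R by rewrite ler_pM2r.
    by have /andP[] := tK w; lra.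
  have [Kw|Kw] := ltnP (K w) (mu w).
    have : s * (mu w)%:R <= tau w * (mu w)%:R by rewrite ler_pM2r // tmin.
    by rewrite tauE; lra.
  have -> : K w = mu w by apply/eqP; rewrite eqn_leq Kmu Kw.
  have : s * (mu w)%:R <= 1 * (mu w)%:R by rewrite ler_pM2r.
  by have := xy w; lra.
exists v; split=> //.
  split=> [w|].
    rewrite ffunE; have [->|_] := eqVneq w v; first by rewrite addn1.
    by rewrite addn0.
  exists s; split=> //; first exact: le_trans ts.
  move=> w; rewrite ffunE; have [->|_] := eqVneq w v; last by rewrite addn0.
  by rewrite addn1 -natr1; have := tauE v; rewrite -/s; lra.
exists (fun w => x w + s * (mu w)%:R); split=> [w|w|w|]; rewrite ?walk_coord.
- have := x_dom w; rewrite -(ler_int rat) rmorphB /= hat_form.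
  have := hat_mu w; rewrite -(ler0z rat) hat_form.
  have muE u : (\sum_w dE w *+ mu w) u = (mu u)%:R.
    by have := walk_coord mu u; rewrite dvalD => /addrI.
  rewrite muE (eq_bigr (fun u => (mu u)%:R)) => [|u _]; last exact: muE.
  move=> H1 H2; rewrite big_split /= -mulr_sumr.
  have := mulr_ge0 (le_trans t0 ts) H1.
  rewrite -[(Posz (valency w))%:~R]/((valency w)%:R) in H2.
  lra.
- by have /andP[] := sK w; lra.
- by have /andP[] := sK w; lra.
- by have := tauE v; rewrite -/s; lra.
Qed.

Lemma walk_bumped K v : walk (bumped K v) = walk K + dE v.
Proof.
apply/val_inj/ffunP => w;
  rewrite [RHS]dvalD [LHS]walk_coord walk_coord !ffunE natrD addrA.
by [].
Qed.

(** Both differences are slice sums, at translates of each other. *)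
Lemma mixed_step K v : admissible_point v (walk K) ->
  count_below (cls y) J (walk K + dE v + lam) - count_below (cls y) J (walk K + lam)
  - count_below (cls y) J (walk K + dE v) + count_below (cls y) J (walk K)
  = if v \in J then hat d v else 0.
Proof.
move=> adm; case: (boolP (v \in J)) => vJ; last first.
  have e z : count_below (cls y) J (z + dE v) = count_below (cls y) J z.
    apply: eq_count_below => l _ i iJ; rewrite dvalD ffunE.
    by rewrite (negbTE (contraNneq _ vJ)) ?addr0 // => <-.
  by rewrite (addrAC (walk K) (dE v)) !e subrr sub0r addNr.
have -> : walk K + dE v + lam = (walk K + lam) + dE v by rewrite addrAC.
rewrite -(cls_walk K) count_below_step //.
have -> : cls (walk K) = cls (walk K + lam).
  by apply/eqP; rewrite clsE opprD addNKr rpredN.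
rewrite count_below_step //.
have -> : slice_sum J v (walk K + lam) = slice_sum J v (walk K + d).
  apply: slice_sum_ext => //; first by rewrite opprD addrACA subrr add0r.
  by move=> i iJ; rewrite !dvalD lamJ.
rewrite slice_sum_shift //; ring.
Qed.

(** The sum of [mixed_step] along the path, on which the step E_v is made mu v
    times. *)
Lemma mixed_difference :
  count_below (cls y) J (walk mu + lam) - count_below (cls y) J (y + lam)
  - count_below (cls y) J (walk mu) + count_below (cls y) J y
  = \sum_(v in J) (mu v)%:Z * hat d v.
Proof.
pose Q K := count_below (cls y) J (walk K + lam) - count_below (cls y) J (walk K).
have main n (K : {ffun V -> nat}) : on_path K -> (\sum_v (mu v - K v) = n)%N ->
    Q mu - Q K = \sum_(v in J) (mu v - K v)%N%:Z * hat d v.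
  elim: n K => [|n IH] K pK sK.
    have Kmu w : K w = mu w.
      apply/eqP; rewrite eqn_leq (proj1 pK) /= -subn_eq0.
      by move/eqP: sK; rewrite sum_nat_eq0 => /forallP/(_ w).
    have -> : (K : V -> nat) = mu by apply: funext.
    by rewrite subrr big1 // => v _; rewrite subnn mul0r.
  have [w Kw] : exists w, K w != mu w.
    apply: contrapT => nex; suff : (\sum_v (mu v - K v) = 0)%N by rewrite sK.
    apply: big1 => v _; apply/eqP; rewrite subn_eq0.
    by case: (eqVneq (K v) (mu v)) => [->//|Kv]; case: nex; exists v.
  have [v [Kv pK' adm]] := path_step pK (ex_intro _ w Kw).
  have sK' : (\sum_w (mu w - bumped K v w) = n)%N.
    move: sK; rewrite (bigD1 v) //= => sK; rewrite (bigD1 v) //= ffunE eqxx addn1.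
    have := Kv; rewrite -subn_gt0 subnS; move: sK.
    rewrite [X in (_ + X)%N = n](eq_bigr (fun w => mu w - K w)%N); last first.
      by move=> u /negbTE uv; rewrite ffunE uv addn0.
    by case: (mu v - K v)%N => //= q; rewrite addSn => -[].
  have stepQ : Q (bumped K v) - Q K = if v \in J then hat d v else 0.
    rewrite -(mixed_step adm) /Q walk_bumped; ring.
  have -> : Q mu - Q K = (Q mu - Q (bumped K v)) + (Q (bumped K v) - Q K) by ring.
  rewrite (IH _ pK' sK') stepQ.
  case: (boolP (v \in J)) => vJ; last first.
    rewrite addr0; apply: eq_bigr => u uJ; rewrite ffunE.
    by rewrite (negbTE (contraNneq _ vJ)) ?addn0 // => <-.
  rewrite (bigD1 v) //= [RHS](bigD1 v) //= ffunE eqxx addn1.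
  rewrite (eq_bigr (fun u => (mu u - K u)%N%:Z * hat d u)); last first.
    by move=> u /andP[_ /negbTE uv]; rewrite ffunE uv addn0.
  have -> : (mu v - K v)%N%:Z = (mu v - (K v).+1)%N%:Z + 1 by lia.
  ring.
have w0 : walk [ffun=> 0%N] = y.
  by apply/val_inj/ffunP => w; rewrite [LHS]walk_coord ffunE addr0.
have p0 : on_path [ffun=> 0%N].
  split=> [w|]; first by rewrite ffunE.
  exists 0; split=> // w; rewrite ffunE mul0r !addr0.
  by have := xy w; have := yx w; lra.
transitivity (Q mu - Q [ffun=> 0%N]); first by rewrite /Q w0; ring.
by rewrite (main _ _ p0 erefl); apply: eq_bigr => v _; rewrite ffunE subn0.
Qed.
End Path.
End Counting.

(** * Mixed second differences of the counting functions *)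

Lemma common_denominator (I : finType) (q : I -> rat) :
  exists2 N : nat, (0 < N)%N & forall i, q i * N%:R \is a Num.int.
Proof.
exists (\prod_i `|denq (q i)|)%N => [|i].
  by apply: prodn_gt0 => i; rewrite absz_gt0 denq_neq0.
rewrite (bigD1 i) //= natrM mulrA rpredM ?rpred_nat //.
by rewrite -[_%:R]/((Posz _)%:~R) gez0_abs ?denq_ge0 // -numqE intr_int.
Qed.

Section MixedDifferences.
Variable T : plumbing_tree.
Local Notation V := (vertex T).
Local Notation LQ := {ffun V -> rat}.
Local Notation L' := (dual_lattice T).
Local Notation H := (discr T).

(** The form restricted to the complement of J is still nondegenerate. *)
Lemma restricted_dual (J : {set V}) (w : V) : w \notin J ->
  exists eta : LQ, (forall u, u \in J -> eta u = 0) /\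
    (forall u, u \notin J -> form eta (E u) = - (u == w)%:R).
Proof.
(* The columns of J are those of the identity, so that they test the vanishing
   of a coordinate. *)
move=> wJ; pose M : 'M[rat]_#|V| := \matrix_(i, j)
  if enum_val j \in J then (i == j)%:R else imatrix T i j.
have rowM (x : 'rV[rat]_#|V|) (y : LQ) u : (forall v, y v = x 0 (enum_rank v)) ->
    (x *m M) 0 (enum_rank u) = if u \in J then y u else form y (E u).
  move=> yE; rewrite mxE; case: ifP => uJ.
    rewrite (bigD1 (enum_rank u)) //= mxE enum_rankK uJ eqxx mulr1 -yE.
    by rewrite big1 ?addr0 // => i iu; rewrite mxE enum_rankK uJ (negbTE iu) mulr0.
  rewrite formE; under [RHS]eq_bigr => v _ do rewrite yE.
  rewrite (sum_imatrix (fun i => x 0 i)); apply: eq_bigr => i _.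
  by rewrite [M _ _]mxE enum_rankK uJ.
have Mu : M \in unitmx.
  rewrite unitmxE unitfE; apply/negP => /det0P[x x0 xM].
  pose y : LQ := [ffun v => x 0 (enum_rank v)].
  have yE v : y v = x 0 (enum_rank v) by rewrite ffunE.
  have y0 u : (if u \in J then y u else form y (E u)) = 0.
    by rewrite -(rowM x) // xM mxE.
  have yz : y = 0.
    apply: form_neg_eq0; rewrite form_sumE big1 // => u _.
    by have := y0 u; case: ifP => _ ->; rewrite ?mul0r ?mulr0.
  move/eqP: x0; apply; apply/rowP => i; rewrite mxE -[i]enum_valK -yE yz ffunE.
  by [].
pose x : 'rV[rat]_#|V| := - delta_mx 0 (enum_rank w) *m invmx M.
pose eta : LQ := [ffun v => x 0 (enum_rank v)].
have eE u : (if u \in J then eta u else form eta (E u)) = - (u == w)%:R.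
  rewrite -(rowM x) => [|v]; last by rewrite ffunE.
  by rewrite mulmxKV // !mxE eqxx (inj_eq enum_rank_inj).
exists eta; split=> u uJ; have := eE u; rewrite ?uJ ?(negbTE uJ) //.
by move=> ->; rewrite (negbTE (contraNneq _ wJ)) ?oppr0 // => <-.
Qed.

Definition in_domain (x : L') : Prop := forall w, (valency w)%:Z - 1 <= hat x w.

Lemma in_domainD (x y : L') : in_domain x -> (forall w, 0 <= hat y w) ->
  in_domain (x + y).
Proof. by move=> xd y0 w; rewrite hatD; have := xd w; have := y0 w; lia. Qed.

Lemma hat_dEstarMn_ge0 (u : V) n w : 0 <= hat (dEstar u *+ n) w.
Proof. by rewrite hatMn hat_dEstar mulrn_wge0. Qed.

Lemma int_combination (y : LQ) : (forall w, y w \is a Num.int) ->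
  exists2 l : L', l \in @in_L T & forall w, l w = y w.
Proof.
move=> yint; exists (\sum_w dE w *~ Num.floor (y w)) => [|w].
  by apply: rpred_sum => w _; apply: rpredMz; apply: in_L_dE.
by rewrite dE_sum floorK.
Qed.

(** For w not in J, d is N Estar w - N eta, where eta is the dual vector of w for
    the subgraph of the vertices off J; N clears all the denominators.  The
    pairings of d with J are sums of coordinates of eta, which are nonnegative
    by [antinef_ge0]. *)
Lemma period_exists : exists2 N : nat, (0 < N)%N & forall w,
  (dEstar w *+ N \in @in_L T) /\
  forall J : {set V}, exists d : L', [/\ dEstar w *+ N - d \in @in_L T,
    forall i, i \in J -> (dEstar w *+ N) i = d i,
    forall i, 0 <= hat d i & forall i, i \notin J -> hat d i = 0].
Proof.
have /choice[eta etaP] (p : {set V} * V) : exists eta : LQ, p.2 \notin p.1 ->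
    (forall u, u \in p.1 -> eta u = 0) /\
    (forall u, u \notin p.1 -> form eta (E u) = - (u == p.2)%:R).
  case: (boolP (p.2 \in p.1)) => pJ; first by exists 0.
  by have [eta eP] := restricted_dual pJ; exists eta.
have [N1 N1_gt0 N1P] := common_denominator (fun p : V * V => Estar p.1 p.2).
have [N2 N2_gt0 N2P] := common_denominator (fun p : ({set V} * V) * V => eta p.1 p.2).
exists (N1 * N2)%N => [|w]; first by rewrite muln_gt0 N1_gt0.
have lL : dEstar w *+ (N1 * N2)%N \in @in_L T.
  apply/forallP => u; rewrite dvalMn -mulr_natr natrM mulrA.
  by rewrite rpredM ?rpred_nat // (N1P (w, u)).
split=> // J; case: (boolP (w \in J)) => wJ.
  exists (dEstar w *+ (N1 * N2)%N); split=> //.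
  - by rewrite subrr rpred0.
  - exact: hat_dEstarMn_ge0.
  - move=> i iJ; rewrite hatMn hat_dEstar (negbTE (contraNneq _ iJ)) ?mul0rn //.
    by move=> <-.
have [eJ eE] := etaP (J, w) wJ.
have [l lint lE] : exists2 l : L', l \in @in_L T
    & forall u, l u = eta (J, w) u * (N1 * N2)%N%:R.
  have [u|l lint lE] := @int_combination [ffun u => eta (J, w) u * (N1 * N2)%N%:R].
    by rewrite ffunE mulnC natrM mulrA rpredM ?rpred_nat // (N2P ((J, w), u)).
  by exists l => // u; rewrite lE ffunE.
have fl u : form l (E u) = form (eta (J, w)) (E u) * (N1 * N2)%N%:R.
  rewrite !form_E mulrDl mulr_suml lE mulrA; congr (_ + _).
  by apply: eq_bigr => v _; rewrite lE.
have e0 u : 0 <= eta (J, w) u.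
  apply: antinef_ge0 => {}u; case: (boolP (u \in J)) => uJ; first by rewrite eJ ?ltxx.
  by move=> _; rewrite eE // oppr_le0 ler0n.
have hl u : (hat l u)%:~R = - form (eta (J, w)) (E u) * (N1 * N2)%N%:R :> rat.
  by rewrite hatE fl mulNr.
have hd0 i : i \notin J -> hat (dEstar w *+ (N1 * N2)%N - l) i = 0.
  move=> iJ; apply: (@intr_inj rat); rewrite hatD hatN hatMn hat_dEstar rmorphB /=.
  rewrite hl eE // opprK eq_sym rmorphMn /=.
  by case: (_ == _); rewrite ?mul1r ?mul0r ?mul0rn subrr.
exists (dEstar w *+ (N1 * N2)%N - l); split=> //.
- by rewrite opprB addrC subrK.
- by move=> i iJ; rewrite dvalB lE eJ // mul0r subr0.
- move=> i; case: (boolP (i \in J)) => iJ; last by rewrite hd0.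
  rewrite hatD hatN addr_ge0 ?hat_dEstarMn_ge0 // oppr_ge0 -(ler_int rat) hl.
  rewrite mulNr oppr_le0 mulr_ge0 ?ler0n // form_E eJ // mulr0 add0r.
  by apply: sumr_ge0 => u _.
Qed.

(** The least point of the class h above x; translates by L round up in the same
    way. *)
Lemma round_up (h : H) (x : L') : exists y : L', [/\ cls y = h,
  forall w, x w <= y w, forall w, y w <= x w + 1 &
  forall J nu, nu \in @in_L T -> count_below h J (x + nu) = count_below h J (y + nu)].
Proof.
pose l0 : L' := repr (h : {ideal_quot @in_L T}).
have l0h : cls l0 = h by rewrite /cls reprK.
pose c w : int := Num.ceil (x w - l0 w).
pose y := l0 + \sum_w dE w *~ c w.
have yE w : y w = l0 w + (c w)%:~R by rewrite /y dvalD dE_sum.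
have clow w : x w - l0 w <= (c w)%:~R by apply: ceil_ge.
have cup w : (c w)%:~R < x w - l0 w + 1.
  by have := ceilB1_lt (x w - l0 w); rewrite rmorphB /= ltrBlDr.
exists y; split=> [|w|w|J nu nuL].
- rewrite -l0h; apply/eqP; rewrite clsE /y addrC addKr; apply: rpred_sum => w _.
  by apply: rpredMz; apply: in_L_dE.
- by rewrite yE; have := clow w; lra.
- by rewrite yE; have := cup w; lra.
apply: eq_count_below => l lh i _; rewrite !(dvalD _ nu) yE.
have /forallP/(_ i)/intrP[k kE] : l - l0 \in @in_L T by rewrite -clsE lh l0h.
have /forallP/(_ i)/intrP[n nE] := nuL.
move: kE; rewrite dvalB nE => kE.
have -> : l i = l0 i + k%:~R by rewrite -kE addrC subrK.
apply/idP/idP => H1; first by have := clow i; lra.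
have kc : k + 1 <= c i + n.
  have : (k%:~R < (c i + n)%:~R :> rat) by rewrite rmorphD /=; lra.
  by rewrite ltr_int; lia.
have : ((k + 1)%:~R <= (c i + n)%:~R :> rat) by rewrite ler_int.
by rewrite !rmorphD /=; have := cup i; lra.
Qed.

Definition mixed (N : nat) (F : L' -> int) (u w : V) (x : L') : int :=
  F (x + dEstar u *+ N + dEstar w *+ N) - F (x + dEstar w *+ N)
  - F (x + dEstar u *+ N) + F x.

(** The value given by [mixed_difference] involves only J, u and w. *)
Lemma count_below_mixed : exists2 N : nat, (0 < N)%N &
  (forall w, dEstar w *+ N \in @in_L T) /\
  forall J u w, exists B : int, forall h x, in_domain x ->
    mixed N (count_below h J) u w x = B.
Proof.
have [N N_gt0 NP] := period_exists; exists N => //; split=> [w|J u w].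
  by have [] := NP w.
have [uL _] := NP u; have [wL /(_ J)[d [dL dJ d0 dout]]] := NP w.
pose mu v : nat := `|Num.floor (N%:R * Estar u v)|%N.
have muE v : (mu v)%:R = N%:R * Estar u v.
  rewrite /mu -[LHS]/((Posz _)%:~R) gez0_abs; last first.
    by rewrite floor_ge0 mulr_ge0 ?ler0n // ltW ?Estar_gt0.
  apply: floorK; have /forallP/(_ v) := uL.
  by rewrite dvalMn mulr_natl.
have mu_gt0 v : (0 < mu v)%N.
  by rewrite -(ltr_nat rat) muE mulr_gt0 ?ltr0n ?Estar_gt0.
have muS : \sum_v dE v *+ mu v = dEstar u *+ N.
  rewrite (eq_bigr (fun v => dE v *~ (mu v)%:Z)) => [|v _]; last by rewrite pmulrn.
  apply/val_inj/ffunP => v; rewrite [LHS]dE_sum [RHS](dvalMn (dEstar u)).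
  by rewrite -mulr_natl -muE.
exists (\sum_(v in J) (mu v)%:Z * hat d v) => h x xd.
have [y [yh xy yx cE]] := round_up h x.
have hmu v : 0 <= hat (\sum_w dE w *+ mu w) v by rewrite muS hat_dEstarMn_ge0.
have := mixed_difference xd xy yx mu_gt0 hmu wL dL dJ d0 dout.
have c0 := cE J 0 (rpred0 _); rewrite !addr0 in c0.
have c2 := cE J _ (rpredD uL wL); rewrite !addrA in c2.
by rewrite yh muS => <-; rewrite /mixed c2 !cE // c0.
Qed.

End MixedDifferences.

(** * Series with rational exponents *)

Section SeriesCalculus.
Variables (V : finType) (R : comNzRingType).
Local Notation LQ := {ffun V -> rat}.
Implicit Types (A B : series V R) (a y z : LQ).

Definition deg (y : LQ) : rat := \sum_v y v.

Lemma degB y z : deg (y - z) = deg y - deg z.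
Proof. by rewrite /deg -sumrB; apply: eq_bigr => v _; rewrite !ffunE. Qed.

Lemma deg0 : deg 0 = 0.
Proof. by rewrite /deg big1 // => v _; rewrite ffunE. Qed.

Lemma degD y z : deg (y + z) = deg y + deg z.
Proof. by rewrite /deg -big_split; apply: eq_bigr => v _; rewrite !ffunE. Qed.

Lemma degMn y n : deg (y *+ n) = deg y *+ n.
Proof. by elim: n => [|n IH]; rewrite ?deg0 // !mulrSr degD IH. Qed.

Lemma deg_sum (I : Type) (r : seq I) (P : pred I) (F : I -> LQ) :
  deg (\sum_(i <- r | P i) F i) = \sum_(i <- r | P i) deg (F i).
Proof. by apply: (big_morph deg); [exact: degD|exact: deg0]. Qed.

(** The Cauchy product is a finite sum as soon as the first factor is, on the
    exponents that can contribute. *)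
Lemma smul_finite (I : finType) A B y (u : I -> R) (al : I -> LQ) :
  (forall z, B (y - z) != 0 -> A z = \sum_i u i * (z == al i)%:R) ->
  smul A B y = \sum_i u i * B (y - al i).
Proof.
move=> AE; pose r := undup [seq al i | i <- enum I].
have term z : A z * B (y - z) = \sum_i u i * (z == al i)%:R * B (y - z).
  have [->|/AE->] := eqVneq (B (y - z)) 0; last by rewrite mulr_suml.
  by rewrite mulr0 big1 // => i _; rewrite mulr0.
have alr i : al i \in r by rewrite mem_undup map_f ?mem_enum.
rewrite /smul (fsbigE r) ?undup_uniq //; last first.
  move=> z _ zr; rewrite term big1 // => i _.
  have -> : (z == al i) = false by apply: contraNF zr => /eqP->.
  by rewrite mulr0 mul0r.
rewrite (eq_bigl xpredT) => [|z]; last by rewrite in_setT.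
under eq_bigr => z _ do rewrite term.
rewrite exchange_big /=; apply: eq_bigr => i _.
rewrite (bigD1_seq (al i)) ?undup_uniq //= eqxx mulr1 big1 ?addr0 // => z /negbTE->.
by rewrite mulr0 mul0r.
Qed.

(** The series \sum_k u_k t^(k a).  At a given exponent z only the finitely many k
    with k deg a <= deg z can contribute; any larger bound M may be used. *)
Definition along a (u : nat -> R) A := forall (M : nat) z,
  deg z < deg a *+ M -> A z = \sum_(k < M) u k * (z == a *+ k)%:R.

Lemma along_neg a u A z : along a u A -> deg z < 0 -> A z = 0.
Proof. by move=> Au z0; rewrite (Au 0) ?mulr0n // big_ord0. Qed.

Lemma along_ext a u u' A : u =1 u' -> along a u A -> along a u' A.
Proof.
by move=> uu Au M z /Au->; apply: eq_bigr => k _; rewrite uu.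
Qed.

Definition cauchy (u u' : nat -> R) (n : nat) : R :=
  \sum_(i < n.+1) u i * u' (n - i)%N.

Lemma sum_triangle (f : nat -> nat -> R) M :
  \sum_(i < M) \sum_(k < M - i) f i k = \sum_(n < M) \sum_(i < n.+1) f i (n - i)%N.
Proof.
elim: M => [|M IH]; first by rewrite !big_ord0.
rewrite [RHS]big_ord_recr /= -IH [in RHS]big_ord_recr /= subnn.
rewrite big_ord_recr /= subSnn big_ord1 addrA -big_split /=; congr (_ + _).
by apply: eq_bigr => i _; rewrite subSn ?big_ord_recr // ltnW.
Qed.

Section Along.
Variable a : LQ.
Hypothesis a_gt0 : 0 < deg a.

Lemma along_smul u u' A B : along a u A -> along a u' B ->
  along a (cauchy u u') (smul A B).
Proof.
move=> Au Bu M z zM.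
rewrite (@smul_finite 'I_M _ _ _ u (fun k => a *+ k)); last first.
  move=> z' Bz; rewrite (Au M) //; apply: le_lt_trans zM.
  by rewrite -subr_ge0 -degB leNgt; apply: contraNN Bz => /(along_neg Bu)->.
transitivity (\sum_(i < M) \sum_(k < M - i) u i * u' k * (z == a *+ (i + k))%:R).
  apply: eq_bigr => i _; rewrite (Bu (M - i)%N).
    rewrite mulr_sumr; apply: eq_bigr => k _.
    by rewrite subr_eq mulrA addrC -mulrnDr.
  by rewrite degB degMn ltrBlDr -mulrnDr subnK // ltnW.
rewrite (sum_triangle (fun i k => u i * u' k * (z == a *+ (i + k))%:R)).
apply: eq_bigr => n _; rewrite mulr_suml; apply: eq_bigr => i _.
by rewrite subnKC // -ltnS.
Qed.

Lemma along_one : along a (fun k => (k == 0%N)%:R) (@sone V R).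
Proof.
move=> [|M] z zM.
  rewrite big_ord0 /sone /smono; case: eqP zM => // ->.
  by rewrite deg0 mulr0n ltxx.
rewrite big_ord_recl mul1r big1 ?addr0 => [|k _]; last by rewrite mul0r.
by rewrite /sone /smono mulr0n; case: eqP.
Qed.

Lemma along_mono g : along a (fun k => g * (k == 1%N)%:R) (smono g a).
Proof.
move=> M z zM; rewrite /smono; case: (eqVneq z a) => [za|za]; last first.
  rewrite big1 // => k _; have [->|_] := eqVneq (k : nat) 1%N;
    last by rewrite mulr0 mul0r.
  by rewrite mulr1n (negbTE za) mulr0.
have M1 : (1 < M)%N.
  by move: zM; rewrite za -[X in X < _]mulr1n ltr_pMn2l.
rewrite (bigD1 (Ordinal M1)) //= za mulr1n eqxx !mulr1 big1 ?addr0 // => k k1.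
have -> : (k == 1%N :> nat) = false by apply: contraNF k1 => /eqP k1; apply/eqP/val_inj.
by rewrite mulr0 mul0r.
Qed.

Lemma along_geom g : along a (fun k => g ^+ k) (sgeom g a).
Proof.
move=> M z zM; rewrite /sgeom (fsbigE (iota 0 M)) ?iota_uniq //.
  rewrite (eq_bigl xpredT) => [|k]; last by rewrite in_setT.
  rewrite -(big_mkord xpredT (fun k => g ^+ k * (z == a *+ k)%:R)) /index_iota subn0.
  by apply: eq_bigr => k _; rewrite /smono; case: eqP; rewrite ?mulr1 ?mulr0.
move=> k _; rewrite mem_iota add0n /= -leqNgt => Mk.
rewrite /smono; case: eqP zM => // ->; rewrite degMn ltr_pMn2l //.
by rewrite ltnNge Mk.
Qed.

Lemma along_sub u u' A B : along a u A -> along a u' B ->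
  along a (fun k => u k - u' k) (fun y => A y - B y).
Proof.
move=> Au Bu M z zM; rewrite (Au M) // (Bu M) // -sumrB.
by apply: eq_bigr => k _; rewrite mulrBl.
Qed.

(** Multiplication by 1 - g t^a takes the difference of the coefficients, up to
    the powers of g; the cases d = 0 and d = 1 are the two negative exponents. *)
Lemma along_binom g (d : nat) :
  along a (fun k => g ^+ k * (iter d nabla ramp k%:Z)%:~R) (sbinom g a (d%:Z - 2)).
Proof.
have geom1 : along a (fun k => g ^+ k) (smul (sgeom g a) (@sone V R)).
  apply: along_ext (along_smul (along_geom g) along_one) => n.
  rewrite /cauchy big_ord_recr /= subnn eqxx mulr1 big1 ?add0r // => i _.
  by rewrite subn_eq0 leqNgt ltn_ord mulr0.
case: d => [|[|d]].
- apply: along_ext (along_smul (along_geom g) geom1) => n.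
  rewrite /cauchy (eq_bigr (fun=> g ^+ n)) => [|i _].
    by rewrite sumr_const card_ord -mulr_natr /ramp /= -PoszD addn1.
  by rewrite -exprD subnKC // -ltnS.
- by apply: along_ext geom1 => n; rewrite /= nabla_ramp // mulr1.
have -> : d.+2%:Z - 2 = d%:Z by lia.
rewrite /sbinom /spow; elim: d => [|d IH].
  apply: along_ext along_one => -[|n]; first by rewrite mulr1.
  have -> : iter 2 nabla ramp n.+1%:Z = 0.
    by rewrite iter_nablaS /= !nabla_ramp ?subrr //; lia.
  by rewrite mulr0.
have fac := along_sub along_one (along_mono g).
apply: along_ext (along_smul fac IH) => n; rewrite iter_nablaS.
have := iter_nabla_vanish d.+2 ramp_vanish.
move: (iter d.+2 nabla ramp) => c c_neg.
rewrite /cauchy big_ord_recl /= subn0 mulr0 subr0 mul1r.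
case: n => [|n]; first by rewrite big_ord0 addr0 expr0 !mul1r [c (0%:Z - 1)]c_neg ?subr0.
rewrite big_ord_recl /= big1 ?addr0 => [|i _]; last by rewrite mulr0 subr0 mul0r.
rewrite (_ : n.+1%:Z - 1 = n%:Z); last by lia.
by rewrite rmorphB mulrBr /bump /= sub0r mulr1 mulNr mulrA -exprS subn1.
Qed.

End Along.

Section Product.
Variables (a : V -> LQ) (u : V -> nat -> R) (A : V -> series V R).
Hypotheses (a_gt0 : forall v, 0 < deg (a v)) (Au : forall v, along (a v) (u v) (A v)).

Definition monomial (S : {set V}) (z : LQ) (k : V -> nat) : R :=
  (\prod_(v in S) u v (k v)) * (z == \sum_(v in S) a v *+ k v)%:R.

Lemma product_formula (r : seq V) M z : uniq r ->
  (forall v, deg z < deg (a v) *+ M.+1) ->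
  (\big[@smul V R/@sone V R]_(v <- r) A v) z
  = \sum_(k : {ffun V -> 'I_M.+1} | supported [set v in r]%SET k)
      monomial [set v in r]%SET z (fun v => k v).
Proof.
elim: r M z => [|v r IH] M z.
  move=> _ _; rewrite big_nil (big_pred1 [ffun=> ord0]) => [|k]; last first.
    apply/forallP/eqP => [H|-> v]; last by rewrite ffunE eqxx implybT.
    by apply/ffunP => v; rewrite ffunE; have := H v; rewrite !inE => /eqP.
  rewrite /monomial !big_pred0 ?mul1r => [|v|v]; rewrite ?inE //.
  by rewrite /sone /smono; case: eqP.
move=> /andP[vr ur] zM; rewrite big_cons.
set B := \big[_/_]_(_ <- r) _.
have Bneg w : deg w < 0 -> B w = 0.
  move=> w0; rewrite /B (IH 0%N) // => [|v']; last first.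
    by rewrite mulr1n; apply: lt_trans w0 (a_gt0 v').
  apply: big1 => k _; rewrite /monomial; case: eqP => [wE|]; last by rewrite mulr0.
  move: w0; rewrite wE deg_sum ltNge sumr_ge0 // => i _.
  by rewrite degMn mulrn_wge0 // ltW.
rewrite (@smul_finite 'I_M.+1 _ _ _ (u v) (fun k => a v *+ k)); last first.
  move=> z' Bz; rewrite (Au (M := M.+1)) //; apply: le_lt_trans (zM v).
  by rewrite -subr_ge0 -degB leNgt; apply: contraNN Bz => /Bneg->.
have -> : [set v0 in v :: r]%SET = (v |: [set v0 in r])%SET.
  by apply/finset.setP => w; rewrite !inE.
have vS : v \notin [set v0 in r]%SET by rewrite inE.
rewrite (sum_box_peel M (F := monomial (v |: [set v0 in r])%SET z) vS); last first.
  move=> k k' kk; rewrite /monomial; congr (_ * _).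
    by apply: eq_bigr => w _; rewrite kk.
  by congr (z == _)%:R; apply: eq_bigr => w _; rewrite kk.
rewrite exchange_big /=; apply: eq_bigr => i _.
rewrite /B (IH M) //; last first.
  move=> v'; apply: le_lt_trans (zM v'); rewrite degB lerBlDr lerDl degMn.
  by rewrite mulrn_wge0 // ltW.
rewrite mulr_sumr; apply: eq_bigr => k _.
have updE w : w \in [set v0 in r]%SET -> upd (fun u0 => k u0 : nat) v i w = k w.
  by rewrite /upd inE; case: eqP => // ->; rewrite (negbTE vr).
have updv : upd (fun u0 => k u0 : nat) v i v = i by rewrite /upd eqxx.
rewrite /monomial !big_setU1 //= !updv -mulrA; congr (_ * (_ * _)).
  by apply: eq_bigr => w wr; rewrite updE.
rewrite subr_eq addrC; congr (z == _ + _)%:R.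
by apply: eq_bigr => w wr; rewrite updE.
Qed.

End Product.
End SeriesCalculus.

(** * The coefficients of the series of the tree *)

Section TreeSeries.
Variable T : plumbing_tree.
Local Notation V := (vertex T).
Local Notation LQ := {ffun V -> rat}.
Local Notation L' := (dual_lattice T).
Local Notation H := (discr T).

Lemma degree_bound (I : finType) (q e : I -> rat) : (forall i, 0 < e i) ->
  exists M : nat, forall i, q i < e i *+ M.+1.
Proof.
move=> e0; exists (\sum_i Num.truncn `|q i / e i|)%N => i.
have -> : e i *+ (\sum_j Num.truncn `|q j / e j|).+1
   = e i * (\sum_j Num.truncn `|q j / e j|).+1%:R by rewrite mulr_natr.
rewrite mulrC -ltr_pdivrMr //; apply: le_lt_trans (ler_norm _) _.
apply: lt_le_trans (truncnS_gt _) _; rewrite ler_nat ltnS.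
by rewrite (bigD1 i) //= leq_addr.
Qed.

Lemma fseries_formula (R : comNzRingType) (g : V -> R) (a : V -> LQ) M z :
  (forall v, 0 < deg (a v)) -> (forall v, deg z < deg (a v) *+ M.+1) ->
  fseries g a z = \sum_(k : {ffun V -> 'I_M.+1})
    (\prod_v (g v ^+ k v * (vertex_coef v (k v : nat)%:Z)%:~R))
      * (z == \sum_v a v *+ k v)%:R.
Proof.
move=> a0 zM; rewrite /fseries.
rewrite (product_formula a0 (fun v => along_binom (a0 v) (g v) (valency v))
  (index_enum_uniq _) zM).
have -> : [set v in index_enum V]%SET = [set: V]%SET.
  by apply/finset.setP => v; rewrite !inE mem_index_enum.
rewrite sum_box_setT; apply: eq_bigr => k _; rewrite /monomial.
congr (_ * (z == _)%:R).
  by apply: eq_bigl => v; rewrite inE.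
by apply: eq_bigl => v; rewrite inE.
Qed.

Lemma deg_Estar_gt0 v : 0 < deg (Estar v : LQ).
Proof.
rewrite /deg (bigD1 v) //= ltr_pwDl ?Estar_gt0 // sumr_ge0 // => w _.
by rewrite ltW ?Estar_gt0.
Qed.

Lemma deg_res_Estar_gt0 (I : {set V}) v : I != finset.set0 ->
  0 < deg (res I (Estar v) : LQ).
Proof.
move=> /set0Pn[i iI]; rewrite /deg (bigD1 i) //= ltr_pwDl //.
  by rewrite ffunE iI Estar_gt0.
by rewrite sumr_ge0 // => w _; rewrite ffunE; case: ifP => // _; rewrite ltW ?Estar_gt0.
Qed.

Definition cone_point (k : V -> nat) : L' := \sum_v dEstar v *+ k v.

Lemma cone_point_val k : dval (cone_point k) = \sum_v (Estar v : LQ) *+ k v.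
Proof.
apply/ffunP => w; rewrite /cone_point dval_sum sum_ffunE; apply: eq_bigr => v _.
by rewrite (dvalMn (dEstar v)) ffunMnE.
Qed.

Lemma hat_cone_point k w : hat (cone_point k) w = (k w)%:Z.
Proof.
rewrite hat_sum (bigD1 w) //= hatMn hat_dEstar eqxx natz.
by rewrite big1 ?addr0 // => v /negbTE vw; rewrite hatMn hat_dEstar vw mul0rn.
Qed.

Lemma cone_pointK (l : L') : (forall w, 0 <= hat l w) -> cone_point (fun w =>
  absz (hat l w)) = l.
Proof. by move=> l0; apply: hat_inj => w; rewrite hat_cone_point gez0_abs. Qed.

Lemma tree_coef_cone_point k : tree_coef (cone_point k) = \prod_v vertex_coef v (k v)%:Z.
Proof. by apply: eq_bigr => v _; rewrite hat_cone_point. Qed.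

Lemma hat_lt_of_dval (l : L') (M : nat) i w : (forall w, 0 <= hat l w) ->
  l i < Estar w i *+ M.+1 -> (absz (hat l w) < M.+1)%N.
Proof.
move=> l0; rewrite dval_hat -mulr_natl => H.
have : (hat l w)%:~R * Estar w i < M.+1%:R * Estar w i.
  apply: le_lt_trans H; rewrite (bigD1 w) //= lerDl sumr_ge0 // => v _.
  by rewrite mulr_ge0 ?ler0z // ltW ?Estar_gt0.
rewrite ltr_pM2r ?Estar_gt0 // -[X in X%:~R](gez0_abs (l0 w)).
by rewrite -[_%:~R]/(_%:R) ltr_nat.
Qed.

Lemma pcoef_tree_coef (l : L') : pcoef l = tree_coef l.
Proof.
have [M lM] := degree_bound (fun=> deg l) deg_Estar_gt0.
rewrite /pcoef (fseries_formula _ deg_Estar_gt0 lM).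
have term (k : {ffun V -> 'I_M.+1}) : (\prod_v ((1 : int) ^+ k v * (vertex_coef
  v (k v : nat)%:Z)%:~R))
    * (dval l == \sum_v Estar v *+ k v)%:R
  = if l == cone_point (fun v => k v) then tree_coef l else 0.
  rewrite -cone_point_val (inj_eq val_inj); case: eqP => [->|_]; last by rewrite mulr0.
  by rewrite mulr1 tree_coef_cone_point; apply: eq_bigr => v _; rewrite expr1n mul1r intz.
under eq_bigr => k _ do rewrite term.
have [p0|p0] := eqVneq (tree_coef l) 0.
  by rewrite big1 // => k _; rewrite p0 if_same.
have l0 := tree_coef_hat_ge0 p0.
have hM w : (absz (hat l w) < M.+1)%N.
  have : deg l < deg (Estar w) *+ M.+1 by [].
  have -> : deg l = \sum_v (hat l v)%:~R * deg (Estar v).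
    rewrite {1}/deg (eq_bigr _ (fun u _ => dval_hat l u)) exchange_big /=.
    by apply: eq_bigr => v _; rewrite -mulr_sumr.
  rewrite -mulr_natl => H0.
  have : (hat l w)%:~R * deg (Estar w) < M.+1%:R * deg (Estar w).
    apply: le_lt_trans H0; rewrite (bigD1 w) //= lerDl sumr_ge0 // => v _.
    by rewrite mulr_ge0 ?ler0z // ltW ?deg_Estar_gt0.
  rewrite ltr_pM2r ?deg_Estar_gt0 // -[X in X%:~R](gez0_abs (l0 w)).
  by rewrite -[_%:~R]/(_%:R) ltr_nat.
pose k0 : {ffun V -> 'I_M.+1} := [ffun w => Ordinal (hM w)].
have k0E : l = cone_point (fun v => k0 v).
  rewrite -[LHS](cone_pointK l0); congr cone_point; apply: funext => w.
  by rewrite ffunE.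
rewrite (bigD1 k0) //= -k0E eqxx big1 ?addr0 // => k kk0; case: eqP => // lk.
case/eqP: kk0; apply/ffunP => w; apply/val_inj/eqP; rewrite -eqz_nat.
by have := congr1 (fun x => hat x w) lk; rewrite k0E !hat_cone_point => ->.
Qed.

Lemma Q_count_below (h : H) (x : L') : Q h x = count_below h [set: V]%SET x.
Proof.
rewrite /Q /count_below /total [LHS]fsbig_mkcond; apply: eq_fsbigr => l _.
rewrite /functions.patch; case: ifP => [/set_mem[nge lh]|nin].
  rewrite pcoef_tree_coef lh eqxx ifT //; apply/existsP; apply: contrapT => nex.
  apply: nge => v; rewrite dvalB subr_ge0 leNgt; apply/negP => lv.
  by apply: nex; exists v; rewrite inE.
case: ifP => // /andP[/eqP lh /existsP[v /andP[_ lv]]].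
move/negP: nin; case; apply/mem_set; split=> // /(_ v).
by rewrite dvalB subr_ge0 leNgt lv.
Qed.

Definition pos_int (q : rat) : bool := (q \is a Num.int) && (0 < q).

Section Tail.
Variable I : {set V}.

Lemma deg_E (v : V) : deg (E v) = 1.
Proof.
rewrite /deg (bigD1 v) //= ffunE eqxx big1 ?addr0 // => w /negbTE wv.
by rewrite ffunE wv.
Qed.

Lemma res_E i : i \in I -> res I (E i) = E i.
Proof.
move=> iI; apply/ffunP => w; rewrite !ffunE; case: ifP => // wI.
by case: eqP => // wi; rewrite wi iI in wI.
Qed.

Lemma tail_formula (M : nat) z : deg z < M.+1%:R ->
  tail I z = \sum_(k : {ffun V -> 'I_M.+1} | supported I k)
    monomial (@E T) (fun _ n => (0 < n)%N%:R : group_ring H) I z (fun v => k v).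
Proof.
move=> zM; rewrite /tail.
rewrite (eq_bigr (fun i => smul (smono 1 (E i)) (sgeom 1 (E i)))); last first.
  by move=> i iI; rewrite res_E.
rewrite -big_filter.
have E0 (v : V) : 0 < deg (E v) by rewrite deg_E.
have al (v : V) : along (E v) (fun n => (0 < n)%N%:R : group_ring H)
     (smul (smono 1 (E v)) (sgeom 1 (E v))).
  apply: along_ext (along_smul (along_mono (E0 v) _) (along_geom (E0 v) _)) => -[|n].
    by rewrite /cauchy big_ord1 /= mulr0 mul0r.
  rewrite /cauchy !big_ord_recl /= big1 => [|i _]; last by rewrite mulr0 mul0r.
  by rewrite mulr0 mul0r add0r addr0 !mul1r expr1n.
rewrite (product_formula E0 al (filter_uniq _ (index_enum_uniq _)) (M := M)); last first.
  by move=> v; rewrite deg_E.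
have -> // : [set v in [seq i <- index_enum V | i \in I]]%SET = I.
by apply/finset.setP => v; rewrite inE mem_filter mem_index_enum andbT.
Qed.

Lemma sum_E_coord (k : V -> nat) w :
  (\sum_(v in I) (E v : LQ) *+ k v) w = if w \in I then (k w)%:R else 0.
Proof.
have mE (v : V) n : ((E v : LQ) *+ n) w = (w == v)%:R *+ n.
  by rewrite ffunMnE ffunE.
rewrite sum_ffunE; case: ifP => wI.
  rewrite (bigD1 w) //= mE eqxx big1 ?addr0 // => v /andP[_ /negbTE vw].
  by rewrite mE eq_sym vw mul0rn.
rewrite big1 // => v vI; rewrite mE (negbTE (contraNneq _ (negbT wI))) ?mul0rn //.
by move=> ->.
Qed.

Lemma tail_neg z : deg z < 0 -> tail I z = 0.
Proof.
move=> z0; rewrite (@tail_formula 0%N) ?(lt_trans z0) //.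
apply: big1 => k _; rewrite /monomial; case: eqP => [zE|]; last by rewrite mulr0.
move: z0; rewrite zE deg_sum ltNge sumr_ge0 // => v _.
by rewrite degMn mulrn_wge0 // deg_E.
Qed.

(** The series is the product of the t_i / (1 - t_i): each monomial whose
    exponents at I are positive integers occurs once. *)
Lemma tail_value (w : LQ) : tail I (res I w) = [forall i in I, pos_int (w i)]%:R.
Proof.
pose M := Num.truncn `|deg (res I w)|.
have zM : deg (res I w) < M.+1%:R by apply: le_lt_trans (ler_norm _) (truncnS_gt _).
rewrite (tail_formula zM).
have coordE (k : V -> nat) : res I w = \sum_(v in I) (E v : LQ) *+ k v ->
    forall i, i \in I -> w i = (k i)%:R.
  by move=> e i iI; have := congr1 (fun y : LQ => y i) e; rewrite ffunE iI sum_E_coord iI.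
case: forallP => wpos; last first.
  apply: big1 => k _; rewrite /monomial; case: eqP => [/coordE kE|];
    last by rewrite mulr0.
  have [i iI ik] : exists2 i, i \in I & k i = 0%N :> nat.
    apply: contrapT => nex; apply: wpos => i; apply/implyP => iI.
    rewrite /pos_int kE // rpred_nat ltr0n lt0n; apply/eqP => ki0.
    by apply: nex; exists i.
  by rewrite (bigD1 i) //= ik !mul0r.
have wn i : i \in I -> exists n : nat, w i = n%:R /\ (0 < n)%N.
  move=> iI; have := wpos i; rewrite iI /= => /andP[/intrP[n ->]].
  by rewrite ltr0z => n0; exists (absz n);
    rewrite absz_gt0 gt_eqF // -[_%:R]/((Posz _)%:~R) gtz0_abs.
pose n i := Num.truncn (w i).
have nE i : i \in I -> w i = (n i)%:R.
  by move=> iI; have [m [wm _]] := wn i iI; rewrite /n wm natrK.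
have n0 i : i \in I -> (0 < n i)%N.
  by move=> iI; have [m [wm m0]] := wn i iI; rewrite /n wm natrK.
have degz : deg (res I w) = \sum_(i in I) (n i)%:R.
  rewrite /deg [RHS]big_mkcond; apply: eq_bigr => i _; rewrite ffunE.
  by case: ifP => // iI; rewrite nE.
have nM i : i \in I -> (n i < M.+1)%N.
  move=> iI; rewrite -(ltr_nat rat); apply: le_lt_trans zM.
  by rewrite degz (bigD1 i) //= lerDl sumr_ge0.
pose k0 : {ffun V -> 'I_M.+1} := [ffun i => if i \in I then inord (n i) else ord0].
have k0E i : i \in I -> k0 i = n i :> nat.
  by move=> iI; rewrite ffunE iI inordK // nM.
have k0s : supported I k0.
  by apply/forallP => i; apply/implyP => /negbTE iI; rewrite ffunE iI.
rewrite (bigD1 k0) //= big1 ?addr0 => [|k /andP[ks kk0]].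
  rewrite /monomial big1 => [|i iI]; last by rewrite k0E // n0.
  rewrite mul1r; suff -> : res I w = \sum_(v in I) E v *+ k0 v by rewrite eqxx.
  by apply/ffunP => i; rewrite ffunE sum_E_coord; case: ifP => // iI; rewrite k0E ?nE.
rewrite /monomial; case: eqP => [/coordE kE|]; last by rewrite mulr0.
case/eqP: kk0; apply/ffunP => i; case: (boolP (i \in I)) => iI.
  apply/val_inj/eqP; rewrite /= -(eqr_nat rat) -kE // nE // k0E //.
by have /forallP/(_ i) := ks; have /forallP/(_ i) := k0s; rewrite iI /= => /eqP-> /eqP->.
Qed.

End Tail.
End TreeSeries.

(** * Equivariant coefficients as counting functions *)

Section GroupRingCoefficients.
Variable H : finZmodType.
Implicit Types (a b : group_ring H) (g h : H).

Lemma gcoef_sum (I : Type) (r : seq I) (P : pred I) (F : I -> group_ring H) h :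
  gcoef (\sum_(i <- r | P i) F i) h = \sum_(i <- r | P i) gcoef (F i) h.
Proof.
by apply: (big_morph (fun a => gcoef a h)) => [a b|]; rewrite /gcoef ffunE.
Qed.

Lemma gcoefMz a (m : int) h : gcoef (a *~ m) h = gcoef a h * m.
Proof.
have Mn n : gcoef (a *+ n) h = gcoef a h *+ n.
  by elim: n => [|n IH]; [rewrite !mulr0n /gcoef ffunE|rewrite !mulrS -IH /gcoef ffunE].
case: m => m; first by rewrite -pmulrn Mn -mulr_natr natz.
rewrite NegzE mulrNz -pmulrn mulrN -natz mulr_natr -Mn.
by rewrite /gcoef ffunE.
Qed.

Lemma gcoef_sign n a h : gcoef ((-1) ^+ n * a) h = (-1) ^+ n * gcoef a h.
Proof.
have -> : (-1) ^+ n * a = a *~ ((-1) ^+ n) by rewrite -mulrzr mulrC rmorphXn rmorphN1.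
by rewrite gcoefMz mulrC.
Qed.

Lemma gcoef_gelt g h : gcoef (gelt g) h = (h == g)%:R.
Proof. by rewrite /gcoef ffunE. Qed.

Lemma geltD g h : gelt (g + h) = gelt g * gelt h.
Proof.
apply/ffunP => k; rewrite !ffunE (bigD1 g) //= !gcoef_gelt eqxx mul1r.
rewrite big1 ?addr0 => [|i /negbTE ig]; last by rewrite gcoef_gelt ig mul0r.
by rewrite subr_eq addrC.
Qed.

Lemma gelt0 : gelt 0 = 1 :> group_ring H. Proof. by []. Qed.

Lemma geltMn g n : gelt (g *+ n) = gelt g ^+ n.
Proof. by elim: n => [|n IH]; rewrite ?mulr0n ?gelt0 // mulrS geltD IH exprS. Qed.

Lemma gelt_sum (I : Type) (r : seq I) (P : pred I) (F : I -> H) :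
  gelt (\sum_(i <- r | P i) F i) = \prod_(i <- r | P i) gelt (F i).
Proof. by apply: (big_morph (@gelt H)); [exact: geltD|exact: gelt0]. Qed.

End GroupRingCoefficients.

(** The alternating sum over all the subsets of P, including the empty one, is
    the product over P of 1 - 1. *)
Lemma inclusion_exclusion (V : finType) (P : {set V}) :
  \sum_(I : {set V} | I != finset.set0) (-1) ^+ (#|I| - 1) * (I \subset P)%:R
  = (P != finset.set0)%:R :> int.
Proof.
have all_sum : \sum_(I : {set V}) (-1) ^+ #|I| * (I \subset P)%:R
    = (P == finset.set0)%:R :> int.
  transitivity (\prod_(i : V) (- (i \in P)%:R + 1) : int); last first.
    have [->|/set0Pn[i iP]] := eqVneq P finset.set0.
      by apply: big1 => i _; rewrite inE oppr0 add0r.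
    by rewrite (bigD1 i) //= iP addNr mul0r.
  rewrite bigA_distr; apply: eq_bigr => I _.
  rewrite -big_mkcond /= prodrN; congr (_ * _).
  case: (boolP (I \subset P)) => [/fintype.subsetP IP|].
    by rewrite big1 // => i /IP->.
  by case/subsetPn => i iI /negbTE iP; rewrite (bigD1 i) //= iP mul0r.
move: all_sum; rewrite (bigD1 finset.set0) //= cards0 expr0 finset.sub0set mul1r.
rewrite (eq_bigr (fun I : {set V} => - ((-1) ^+ (#|I| - 1) * (I \subset P)%:R))).
  rewrite sumrN; move: (\sum_(_ | _) _) => S.
  by case: (P == _) => /= SE; rewrite -[LHS](subKr 1) SE ?subrr ?subr0.
move=> I I0; have : (0 < #|I|)%N by rewrite card_gt0.
by case: #|I| => // n _; rewrite subn1 /= exprS mulN1r mulNr.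
Qed.

Section TopologicalCoefficients.
Variable T : plumbing_tree.
Local Notation V := (vertex T).
Local Notation LQ := {ffun V -> rat}.
Local Notation L' := (dual_lattice T).
Local Notation H := (discr T).

Lemma clsD (x y : L') : cls (x + y) = cls x + cls y.
Proof. exact: raddfD. Qed.

Lemma cls0 : cls (0 : L') = 0.
Proof. by apply: (addrI (cls 0)); rewrite -clsD !addr0. Qed.

Lemma clsMn (x : L') n : cls (x *+ n) = cls x *+ n.
Proof. by elim: n => [|n IH]; rewrite ?cls0 // !mulrS clsD IH. Qed.

Lemma cls_sum (I : Type) (r : seq I) (P : pred I) (F : I -> L') :
  cls (\sum_(i <- r | P i) F i) = \sum_(i <- r | P i) cls (F i).
Proof. by apply: (big_morph (@cls T)); [exact: clsD|exact: cls0]. Qed.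

Lemma resE (I : {set V}) (y : LQ) v : res I y v = if v \in I then y v else 0.
Proof. by rewrite ffunE. Qed.

Lemma C_H_term (I : {set V}) (x : L') M h : I != finset.set0 ->
  (forall i w, x i < Estar w i *+ M.+1) ->
  gcoef (smul (fH I) (tail I) (res I x)) h
  = \sum_(k : {ffun V -> 'I_M.+1}) tree_coef (cone_point (fun v => k v)) *
      ((cls (cone_point (fun v => k v)) == h)
       && [forall i in I, pos_int (x i - cone_point (fun v => k v) i)])%:R.
Proof.
move=> I0 xM; have dres v := deg_res_Estar_gt0 v I0.
have xd v : deg (res I x) < deg (res I (Estar v)) *+ M.+1.
  have [i iI] := set0Pn _ I0.
  rewrite /deg -sumrMnl (bigD1 i) //= [ltRHS](bigD1 i) //= ltr_leD //.
    by rewrite !resE iI.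
  apply: ler_sum => w _; rewrite !resE; case: ifP => _; first exact/ltW.
  by rewrite mul0rn.
rewrite (@smul_finite _ _ {ffun V -> 'I_M.+1} _ _ _ (fun k => \prod_v (gelt (cls
  (dEstar v)) ^+ k v
     * (vertex_coef v (k v : nat)%:Z)%:~R)) (fun k => \sum_v res I (Estar v) *+
       k v)); last first.
  move=> z tz; rewrite /fH (@fseries_formula _ _ _ _ M) // => v.
  apply: le_lt_trans (xd v); rewrite -subr_ge0 -degB leNgt.
  by apply: contraNN tz => /tail_neg->.
rewrite gcoef_sum; apply: eq_bigr => k _.
have -> : res I x - \sum_v res I (Estar v) *+ k v
    = res I (dval (x - cone_point (fun v => k v))).
  apply/ffunP => w; rewrite [RHS]resE dvalB cone_point_val.
  have -> : (res I x - \sum_v res I (Estar v) *+ k v) w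
      = res I x w - (\sum_v res I (Estar v) *+ k v) w by rewrite [LHS]ffunE;
        congr (_ + _); rewrite [LHS]ffunE.
  rewrite resE !sum_ffunE; case: ifP => wI.
    by congr (_ - _); apply: eq_bigr => v _; rewrite !ffunMnE resE wI.
  by rewrite big1 ?subr0 // => v _; rewrite ffunMnE resE wI mul0rn.
rewrite tail_value big_split /= -rmorph_prod /= -tree_coef_cone_point.
have -> : \prod_v gelt (cls (dEstar v)) ^+ k v = gelt (cls (cone_point (fun v => k v))).
  by rewrite cls_sum gelt_sum; apply: eq_bigr => v _; rewrite clsMn geltMn.
have -> : [forall i in I, pos_int ((x - cone_point (fun v => k v)) i)]
    = [forall i in I, pos_int (x i - cone_point (fun v => k v) i)].
  by apply: eq_forallb => i; rewrite dvalB.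
case: [forall i in I, _]; last by rewrite !andbF !mulr0 /gcoef ffunE.
by rewrite mulr1 mulrzr gcoefMz gcoef_gelt andbT eq_sym mulrC.
Qed.

(** The coefficient at I collects the l with x_i - l_i a positive integer for all
    i in I.  When l has the class of l0, integrality at i depends on x only, and
    inclusion and exclusion leaves the l with l_i < x_i for some i in J. *)
Lemma C_H_count_below (x l0 : L') :
  gcoef (C_H x) (cls l0)
  = count_below (cls l0) [set i | x i - l0 i \is a Num.int]%SET x.
Proof.
set J := [set i | _]%SET.
have [M xM'] := degree_bound (fun p : V * V => x p.1) (fun p => Estar_gt0 p.2 p.1).
have xM i w : x i < Estar w i *+ M.+1 := xM' (i, w).
rewrite /C_H gcoef_sum.
rewrite (eq_bigr (fun I : {set V} => \sum_(k : {ffun V -> 'I_M.+1})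
   (-1) ^+ (#|I| - 1) * (tree_coef (cone_point (fun v => k v)) *
      ((cls (cone_point (fun v => k v)) == cls l0)
       && [forall i in I, pos_int (x i - cone_point (fun v => k v) i)])%:R))); last first.
  by move=> I I0; rewrite gcoef_sign (C_H_term _ I0 xM) mulr_sumr.
rewrite exchange_big /= /count_below.
pose i (k : {ffun V -> 'I_M.+1}) := cone_point (fun v => k v).
have inj : injective i.
  move=> k k' kk; apply/ffunP => u; apply/val_inj/eqP; rewrite -eqz_nat.
  by have := congr1 (fun l => hat l u) kk; rewrite !hat_cone_point => ->.
rewrite (total_image inj) => [|l]; last first.
  case: ifP => [/andP[_ /existsP[u /andP[_ lu]]] pl|]; last by rewrite eqxx.
  have l0' := tree_coef_hat_ge0 pl.
  have hM w : (absz (hat l w) < M.+1)%N.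
    by apply: (hat_lt_of_dval (i := u)) => //; apply: lt_trans lu (xM u w).
  exists [ffun w => Ordinal (hM w)]; rewrite -[LHS](cone_pointK l0') /i; congr cone_point.
  by apply: funext => w; rewrite ffunE.
apply: eq_bigr => k _; rewrite -/(i k); set l := i k.
case: eqP => lh /=; last by rewrite big1 // => I _; rewrite !mulr0.
pose P := [set u | pos_int (x u - l u)]%SET.
rewrite (eq_bigr (fun I : {set V} => tree_coef l * ((-1) ^+ (#|I| - 1) * (I
  \subset P)%:R))); last first.
  move=> I _; suff -> : [forall u in I, pos_int (x u - l u)] = (I \subset P).
    by rewrite mulrCA.
  apply/forallP/fintype.subsetP => [IP u uI|IP u].
    by have := IP u; rewrite uI inE.
  by apply/implyP => /IP; rewrite inE.
rewrite -mulr_sumr inclusion_exclusion.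
have lint u : l u - l0 u \is a Num.int.
  have : l - l0 \in @in_L T by rewrite -clsE lh.
  by move/forallP/(_ u); rewrite dvalB.
have -> : (P != finset.set0) = [exists u in J, l u < x u].
  apply/set0Pn/existsP => -[u]; rewrite !inE.
    move=> /andP[ui up]; exists u; rewrite -subr_gt0 up andbT inE.
    have -> : x u - l0 u = (x u - l u) + (l u - l0 u) by ring.
    by rewrite rpredD.
  move=> /andP[uJ lu]; exists u; rewrite inE /pos_int subr_gt0 lu andbT.
  have -> : x u - l u = (x u - l0 u) - (l u - l0 u) by ring.
  by rewrite rpredB.
by case: ifP => _; rewrite ?mulr1 ?mulr0.
Qed.

End TopologicalCoefficients.

(** * Quasipolynomials *)

(** To be used with S = {0} and with S the integers. *)
Section PolynomialTail.
Variable S : rat -> Prop.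
Hypotheses (S0 : S 0) (SB : forall a b, S a -> S b -> S (a - b)).

(** The leading terms cancel, since (X + 1)^i - X^i has degree i - 1. *)
Lemma size_shift_sub (p : {poly rat}) n : (size p <= n.+1)%N ->
  (size (p \Po ('X + 1%:P) - p)%R <= n)%N.
Proof.
move=> pn; rewrite comp_polyE -[X in _ - X]coefK poly_def -sumrB.
apply: (leq_trans (size_sum _ _ _)); apply/bigmax_leqP => i _.
rewrite -scalerBr; apply: (leq_trans (size_scale_leq _ _)).
have iN : (i <= n)%N by rewrite -ltnS (leq_trans _ pn).
apply: leq_trans iN; rewrite subrXX addrAC subrr add0r mul1r.
apply: (leq_trans (size_sum _ _ _)); apply/bigmax_leqP => j _.
have sizeX m : size (('X + 1%:P : {poly rat}) ^+ m) = m.+1.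
  by rewrite -[1%:P]opprK -polyCN size_exp_XsubC.
rewrite size_Mmonic ?monicXn //; last by rewrite -size_poly_eq0 sizeX.
by rewrite size_polyXn sizeX; have := ltn_ord j; lia.
Qed.

(** Induction on the degree: p (k) = p (k + 1) - q (k), where q is the forward
    difference of p, for which the claim holds at all k. *)
Lemma poly_tail (p : {poly rat}) k0 :
  (forall k, (k0 <= k)%N -> S p.[k%:R]) -> forall k, S p.[k%:R].
Proof.
have [n] := ubnP (size p); elim: n p k0 => // n IH p k0.
rewrite ltnS => pn pS; have [sp0|sp] := posnP (size p).
  by move/eqP: sp0; rewrite size_poly_eq0 => /eqP-> k; rewrite horner0.
pose q := p \Po ('X + 1%:P) - p.
have qE k : q.[k%:R] = p.[k.+1%:R] - p.[k%:R].
  by rewrite !hornerE horner_comp !hornerE natr1.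
have qS : forall k, S q.[k%:R].
  apply: (IH q k0) => [|k kk]; last by rewrite qE; apply: SB; apply: pS; rewrite // ltnW.
  by case: (n) pn => [|n'] pn; [case: (size p) sp pn|rewrite ltnS size_shift_sub].
have desc d : forall k, (k0 <= k + d)%N -> S p.[k%:R].
  elim: d => [|d IHd] k kd; first by apply: pS; rewrite -[k]addn0.
  have -> : p.[k%:R] = p.[k.+1%:R] - q.[k%:R] by rewrite qE opprB addrC subrK.
  by apply: SB => //; apply: IHd; rewrite addSnnS.
by move=> k; apply: (desc k0); rewrite leq_addl.
Qed.

End PolynomialTail.

Section Quasipolynomials.
Variable T : plumbing_tree.
Local Notation V := (vertex T).
Local Notation L' := (dual_lattice T).

Lemma chamberP (x : L') : chamber x <-> in_domain x.
Proof.
split=> [[s [m m0 ->] ->] w|xd].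
  rewrite hatD hat_sum_dEstar hat_cone_point /excess; have := m0 w; lia.
exists (cone_point (fun w => `|hat x w - excess w|%N)).
  exists (fun w => `|hat x w - excess w|%N) => // w.
  by have := xd w; rewrite /excess; lia.
apply: hat_inj => w; rewrite hatD hat_sum_dEstar hat_cone_point.
by have := xd w; rewrite /excess; lia.
Qed.

(** Two of the multiples of s lie in the same coset. *)
Lemma finite_index_multiple (M : {pred L'}) (s : L') : zmod_closed M ->
  finite_index M -> exists2 N : nat, (0 < N)%N & s *+ N \in M.
Proof.
move=> [M0 MB] [reps repsP].
have /choice[rep repP] (n : nat) : exists r, r \in reps /\ s *+ n - r \in M.
  by have [r rr rM] := repsP (s *+ n); exists r.
have [i [j [ij rij]]] : exists i j : 'I_(size reps).+1, (i < j)%N /\ rep i = rep j.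
  have : ~ injective (fun n : 'I_(size reps).+1 => Ordinal (etrans (index_mem
    (rep n) reps) (proj1 (repP n)))).
    by move/leq_card; rewrite !card_ord ltnn.
  move=> ninj; apply: contrapT => nex; apply: ninj => i j ij.
  have rr : rep i = rep j.
    have := congr1 val ij => /= /(congr1 (nth 0 reps)).
    by rewrite !nth_index ?(proj1 (repP _)).
  apply/val_inj => /=; have [lt|lt|//] := ltngtP (i : nat) (j : nat); case: nex.
    by exists i, j.
  by exists j, i.
exists (j - i)%N; first by rewrite subn_gt0.
rewrite mulrnBr ?(ltnW ij) //.
have -> : s *+ j - s *+ i = (s *+ j - rep j) - (s *+ i - rep i).
  by rewrite rij opprB addrA subrK.
by apply: MB; [case: (repP j)|case: (repP i)].
Qed.

(** The points x + k N s, with N s in the period lattice, stay in one coset. *)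
Lemma quasipolynomial_line (f : L' -> rat) (x s : L') : quasipolynomial f ->
  exists2 N : nat, (0 < N)%N & exists p : {poly rat},
    forall k : nat, f (x + s *+ (N * k)) = p.[k%:R].
Proof.
move=> [M [Mz Mf fP]]; have [N N0 sM] := finite_index_multiple s Mz Mf.
exists N => //; have [P PE] := fP x.
exists (\sum_(m <- mpoly.msupp P) (mpoly.mcoeff m P)%:P *
   \prod_i ((x (enum_val i))%:P + (s (enum_val i) *+ N)%:P * 'X)
       ^+ mpoly.fun_of_multinom m i) => k.
rewrite PE; last first.
  rewrite addrC addKr mulrnA; elim: k => [|k IH]; first by case: Mz.
  rewrite mulrSr; case: Mz => M0 MB.
  have -> : s *+ N *+ k + s *+ N = s *+ N *+ k - (0 - s *+ N) by rewrite sub0r opprK.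
  by apply: (MB _ _ IH); apply: MB.
rewrite mpoly.mevalE horner_sum; apply: eq_bigr => m _.
rewrite hornerM hornerC horner_prod; congr (_ * _); apply: eq_bigr => i _.
rewrite horner_exp !hornerE dvalD dvalMn; congr (_ ^+ _).
by rewrite mulrnA mulr_natr.
Qed.

Definition far : L' := \sum_v dEstar v *~ 1.

Lemma far_domain (x : L') : exists k0 : nat, forall k, (k0 <= k)%N -> in_domain
  (x + far *+ k).
Proof.
exists (\sum_v `|(valency v)%:Z - hat x v|)%N => k kk w.
rewrite hatD hatMn hat_sum_dEstar natz.
have : (`|(valency w)%:Z - hat x w| <= k)%N.
  by apply: leq_trans kk; rewrite (bigD1 w) //= leq_addr.
lia.
Qed.

Lemma quasipolynomial_eq (f g : L' -> rat) : quasipolynomial f ->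
  quasipolynomial g -> (forall x, in_domain x -> f x = g x) -> f = g.
Proof.
move=> fq gq fg; apply: funext => x.
have [N1 N1_gt0 [p pE]] := quasipolynomial_line x far fq.
have [N2 N2_gt0 [q qE]] := quasipolynomial_line x far gq.
(* The two periods are matched by sampling both functions at the multiples of
   N1 * N2. *)
pose d := (p \Po (N2%:R *: 'X)) - (q \Po (N1%:R *: 'X)).
have dE k : d.[k%:R] = f (x + far *+ (N1 * N2 * k)) - g (x + far *+ (N1 * N2 * k)).
  rewrite !hornerE !horner_comp !hornerE -!natrM -pE -qE.
  by rewrite mulnA -(mulnA N1) mulnA [in X in _ - g X]mulnA (mulnC N1 N2).
have [k0 k0P] := far_domain x.
have := @poly_tail (fun a => a = 0) erefl _ d k0 _ 0%N.
rewrite dE muln0 mulr0n addr0 => H; apply/eqP; rewrite -subr_eq0; apply/eqP/H.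
  by move=> a b -> ->; rewrite subr0.
move=> k kk; rewrite dE fg ?subrr //; apply: k0P; apply: leq_trans kk _.
by rewrite leq_pmull // muln_gt0 N1_gt0.
Qed.

Lemma quasipolynomial_int (f : L' -> rat) : quasipolynomial f ->
  (forall x, in_domain x -> f x \is a Num.int) -> forall x, f x \is a Num.int.
Proof.
move=> fq fint x; have [N N_gt0 [p pE]] := quasipolynomial_line x far fq.
have [k0 k0P] := far_domain x.
have := @poly_tail (fun a => a \is a Num.int) (rpred0 _) _ p k0 _ 0%N.
rewrite -pE muln0 mulr0n addr0; apply.
  by move=> a b; apply: rpredB.
move=> k kk; rewrite -pE; apply/fint/k0P/(leq_trans kk).
by rewrite leq_pmull.
Qed.

Definition polynomial_function (f : L' -> rat) : Prop :=
  exists P : mpoly.mpoly #|V| rat,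
    forall x : L', f x = mpoly.meval (fun i => x (enum_val i)) P.

Lemma polynomialC c : polynomial_function (fun=> c).
Proof. by exists (mpoly.mpolyC _ c) => x; rewrite mpoly.mevalC. Qed.

Lemma polynomial_coord v : polynomial_function (fun x => x v).
Proof.
exists (mpoly.mpolyX _ (mpoly.mnm1 (enum_rank v))) => x.
by rewrite mpoly.mevalXU enum_rankK.
Qed.

Lemma polynomialD f g : polynomial_function f -> polynomial_function g ->
  polynomial_function (fun x => f x + g x).
Proof.
by move=> [P PE] [Q QE]; exists (P + Q) => x; rewrite mpoly.mevalD PE QE.
Qed.

Lemma polynomialM f g : polynomial_function f -> polynomial_function g ->
  polynomial_function (fun x => f x * g x).
Proof.
by move=> [P PE] [Q QE]; exists (P * Q) => x; rewrite mpoly.mevalM PE QE.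
Qed.

Lemma polynomial_sum (I : Type) (r : seq I) (P : pred I) (f : I -> L' -> rat) :
  (forall i, polynomial_function (f i)) ->
  polynomial_function (fun x => \sum_(i <- r | P i) f i x).
Proof.
move=> fP; elim: r => [|i r IH].
  have [Q QE] := polynomialC 0; exists Q => x; rewrite big_nil; exact: QE.
case Pi: (P i).
  have [Q QE] := polynomialD (fP i) IH; exists Q => x; rewrite big_cons Pi; exact: QE.
by have [Q QE] := IH; exists Q => x; rewrite big_cons Pi; exact: QE.
Qed.

Lemma polynomial_hat w : polynomial_function (fun x => (hat x w)%:~R).
Proof.
have [P PE] : polynomial_function
    (fun x => (-1) * ((euler w)%:~R * x w + \sum_(u | edge w u) x u)).
  apply: polynomialM (polynomialC _) (polynomialD _ (polynomial_sum _ _ _)).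
    exact: polynomialM (polynomialC _) (polynomial_coord _).
  by move=> u; apply: polynomial_coord.
by exists P => x; rewrite -PE hat_form mulN1r.
Qed.

Section Extension.
Variables (N : nat) (F : L' -> int).
Hypothesis N_gt0 : (0 < N)%N.
Hypothesis mixed_periodic : forall x u w t, in_domain x ->
  mixed N F u w (x + dEstar t *+ N) = mixed N F u w x.

Definition incr_at (n : V -> nat) (t : V) : V -> nat := fun v => (n v + (v == t))%N.

Lemma nat_fun_ind (P : (V -> nat) -> Prop) : P (fun=> 0%N) ->
  (forall n t, P n -> P (incr_at n t)) -> forall n, P n.
Proof.
move=> P0 PS n; have [m] := ubnP (\sum_v n v)%N; elim: m n => // m IH n.
rewrite ltnS => nm; have [t tn|n0] := pickP (fun t => 0 < n t)%N; last first.
  suff -> : n = (fun=> 0%N) by [].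
  by apply: funext => v; have := n0 v; case: (n v).
have -> : n = incr_at (fun v => n v - (v == t))%N t.
  apply: funext => v; rewrite /incr_at; case: eqP => [->|]; last by rewrite subn0 addn0.
  by rewrite subnK.
apply/PS/IH; apply: leq_trans nm; rewrite (bigD1 t) //= [ltnRHS](bigD1 t) //=.
rewrite eqxx (eq_bigr n) => [|v /negbTE->]; last by rewrite subn0.
by rewrite -addSn leq_add2r subn1 prednK.
Qed.

Definition grid (b : L') (n : V -> nat) : L' := b + \sum_v dEstar v *+ (N * n v)%N.

Lemma grid_bump b n t : grid b (incr_at n t) = grid b n + dEstar t *+ N.
Proof.
rewrite /grid -addrA; congr (_ + _); rewrite (bigD1 t) //= [in RHS](bigD1 t) //=.
rewrite /incr_at eqxx mulnDr muln1 mulrnDr -!addrA; congr (_ + _).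
rewrite addrC; congr (_ + _).
by apply: eq_bigr => v /negbTE->; rewrite addn0.
Qed.

Lemma grid0 b : grid b (fun=> 0%N) = b.
Proof. by rewrite /grid big1 ?addr0 // => v _; rewrite muln0. Qed.

Lemma grid_domain b n : in_domain b -> in_domain (grid b n).
Proof.
move=> bd; apply: in_domainD => // w; rewrite hat_sum; apply: sumr_ge0 => v _.
exact: hat_dEstarMn_ge0.
Qed.

Variable b : L'.
Hypothesis b_dom : in_domain b.
Let B u w : int := mixed N F u w b.
Let D u : int := F (b + dEstar u *+ N) - F b.

Lemma mixed_grid n u w : mixed N F u w (grid b n) = B u w.
Proof.
elim/nat_fun_ind: n => [|n t IH]; first by rewrite grid0.
by rewrite grid_bump mixed_periodic //; apply: grid_domain.
Qed.

Lemma mixedC u w x : mixed N F u w x = mixed N F w u x.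
Proof. by rewrite /mixed [x + _ + _]addrAC; ring. Qed.

Lemma first_difference n u : F (grid b n + dEstar u *+ N) - F (grid b n)
  = D u + \sum_w (n w)%:Z * B u w.
Proof.
elim/nat_fun_ind: n => [|n t IH].
  by rewrite grid0 big1 ?addr0 // => w _; rewrite mul0r.
rewrite grid_bump.
have -> : \sum_w (incr_at n t w)%:Z * B u w = \sum_w (n w)%:Z * B u w + B u t.
  rewrite (bigD1 t) //= [in RHS](bigD1 t) //= /incr_at eqxx addn1.
  rewrite (eq_bigr (fun w => (n w)%:Z * B u w)) => [|w /negbTE->]; last by rewrite addn0.
  by rewrite intS; ring.
rewrite addrA -IH -(mixed_grid n u t) /mixed [grid b n + _ + _]addrAC.
ring.
Qed.

(** The function on the grid with value F b at 0, first differences D u at 0 and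
    constant mixed differences B u w. *)
Definition quadratic (n : V -> rat) : rat :=
  (F b)%:~R + (\sum_u n u * (2 * (D u)%:~R - (B u u)%:~R
     + \sum_w n w * (B u w)%:~R)) / 2.

Lemma grid_value n : (F (grid b n))%:~R = quadratic (fun v => (n v)%:R).
Proof.
elim/nat_fun_ind: n => [|n t IH].
  by rewrite grid0 /quadratic big1 ?mul0r ?addr0 // => u _; rewrite mul0r.
have -> : F (grid b (incr_at n t))
    = F (grid b n) + (D t + \sum_w (n w)%:Z * B t w).
  by rewrite -first_difference grid_bump [RHS]addrC subrK.
rewrite !rmorphD /= IH rmorph_sum /= /quadratic -addrA; congr (_ + _).
pose c u : rat := 2 * (D u)%:~R - (B u u)%:~R.
pose r u : rat := \sum_w (n w)%:R * (B u w)%:~R.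
have bE v : (incr_at n t v)%:R = (n v)%:R + (v == t)%:R :> rat by rewrite /incr_at natrD.
have inner u : \sum_w (incr_at n t w)%:R * (B u w)%:~R = r u + (B u t)%:~R :> rat.
  under eq_bigr => w _ do rewrite bE mulrDl.
  rewrite big_split /=; congr (_ + _).
  by rewrite (bigD1 t) //= eqxx mul1r big1 ?addr0 // => w /negbTE->; rewrite mul0r.
have -> : \sum_u (incr_at n t u)%:R * (2 * (D u)%:~R - (B u u)%:~R
     + \sum_w (incr_at n t w)%:R * (B u w)%:~R)
   = \sum_u ((n u)%:R * (c u + r u)) + (c t + r t + (B t t)%:~R)
     + \sum_u (n u)%:R * (B u t)%:~R.
  have -> : c t + r t + (B t t)%:~R = \sum_(u | u == t) (c u + r u + (B u t)%:~R).
    by rewrite big_pred1_eq.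
  rewrite [X in _ + X + _]big_mkcond -!big_split /=; apply: eq_bigr => u _.
  rewrite bE inner -/(c u); case: eqP => _ /=; ring.
have -> : \sum_u (n u)%:R * (B u t)%:~R = r t.
  by apply: eq_bigr => u _; rewrite /B mixedC.
have -> : \sum_i (((n i)%:Z * B t i)%:~R : rat) = r t.
  by apply: eq_bigr => u _; rewrite rmorphM.
have -> : \sum_u (n u)%:R * (2 * (D u)%:~R - (B u u)%:~R + \sum_w (n w)%:R * (B u w)%:~R)
  = \sum_u (n u)%:R * (c u + r u) :> rat by [].
by rewrite /c /D !(rmorphD, rmorphN) /=; field.
Qed.

End Extension.
End Quasipolynomials.

(** * Extension and conclusion *)

Section ExtensionExists.
Variable T : plumbing_tree.
Local Notation V := (vertex T).
Local Notation L' := (dual_lattice T).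
Local Notation H := (discr T).
Variables (N : nat) (F : L' -> int).
Hypothesis N_gt0 : (0 < N)%N.
Hypothesis mixed_periodic : forall x u w t, in_domain x ->
  mixed N F u w (x + dEstar t *+ N) = mixed N F u w x.

Definition corner (v : V) : int := (valency v)%:Z - 1.

(** The points of the chamber closest to its vertex represent the cosets of N L';
    [steps] counts the translations by N Estar v from the representative. *)
Definition base (x : L') : L' :=
  \sum_v dEstar v *~ (corner v + ((hat x v - corner v) %% N)%Z).

Definition steps (x : L') (v : V) : int := ((hat x v - corner v) %/ N)%Z.

Lemma hat_base x v : hat (base x) v = corner v + ((hat x v - corner v) %% N)%Z.
Proof. exact: hat_sum_dEstar. Qed.

Lemma N_neq0 : (N : int) != 0.
Proof. by rewrite -lt0n. Qed.

Lemma hat_stepsE x v : hat x v = hat (base x) v + steps x v * N.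
Proof.
rewrite hat_base /steps -addrA [_ + _ * _]addrC -divz_eq; ring.
Qed.

Lemma base_domain x : in_domain (base x).
Proof. by move=> v; rewrite hat_base /corner lerDl modz_ge0 ?N_neq0. Qed.

Lemma steps_ge0 x v : in_domain x -> 0 <= steps x v.
Proof. by move=> xd; rewrite /steps divz_ge0 ?ltz_nat // subr_ge0; apply: xd. Qed.

Lemma grid_base x : in_domain x -> grid N (base x) (fun v => absz (steps x v)) = x.
Proof.
move=> xd; apply: hat_inj => w; rewrite hatD hat_cone_point PoszM.
by rewrite gez0_abs ?steps_ge0 // [N%:Z * _]mulrC -hat_stepsE.
Qed.

Definition extension (x : L') : rat :=
  quadratic N F (base x) (fun v => (steps x v)%:~R).

Lemma extension_domain x : in_domain x -> extension x = (F x)%:~R.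
Proof.
move=> xd; rewrite -{2}(grid_base xd) (grid_value mixed_periodic (base_domain x)).
congr quadratic; apply: funext => v.
by rewrite -[RHS]/((Posz _)%:~R) gez0_abs ?steps_ge0.
Qed.

Definition period : {pred L'} := fun x => [forall w, (N %| hat x w)%Z].

Lemma period_zmod : zmod_closed period.
Proof.
split=> [|x y /forallP xN /forallP yN]; apply/forallP => w.
  by rewrite hat0 dvdz0.
by rewrite hatD hatN rpredB ?xN ?yN.
Qed.

Lemma period_finite_index : finite_index period.
Proof.
exists [seq cone_point (fun v => (k : {ffun V -> 'I_N}) v) | k <- enum {: {ffun
  V -> 'I_N}}] => x.
have b w : (absz (hat x w %% N)%Z < N)%N.
  by rewrite -ltz_nat gez0_abs ?modz_ge0 ?N_neq0 // ltz_pmod.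
exists (cone_point (fun w => absz (hat x w %% N)%Z)).
  apply/mapP; exists [ffun w => Ordinal (b w)]; first by rewrite mem_enum.
  by apply: eq_bigr => v _; rewrite ffunE.
apply/forallP => w; rewrite hatD hatN hat_cone_point gez0_abs ?modz_ge0 ?N_neq0 //.
by rewrite -eqz_mod_dvd modz_mod.
Qed.

Lemma extension_quasipolynomial : quasipolynomial extension.
Proof.
exists period; split; [exact: period_zmod|exact: period_finite_index|] => x0.
pose n x w : rat := ((hat x w)%:~R + (- (hat (base x0) w)%:~R)) * N%:R^-1.
have np w : polynomial_function (fun x => n x w).
  exact: (polynomialM (polynomialD (polynomial_hat w) (polynomialC T _))
    (polynomialC T _)).
have [P PE] : polynomial_function (fun x => quadratic N F (base x0) (n x)).
  rewrite /quadratic.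
  have inner u := polynomial_sum (index_enum V) xpredT
    (fun w => polynomialM (np w) (polynomialC T (mixed N F u w (base x0))%:~R)).
  have outer := polynomial_sum (index_enum V) xpredT
    (fun u => polynomialM (np u) (polynomialD (polynomialC T
       (2 * (F (base x0 + dEstar u *+ N) - F (base x0))%:~R
        - (mixed N F u u (base x0))%:~R)) (inner u))).
  exact: (polynomialD (polynomialC T _) (polynomialM outer (polynomialC T _))).
exists P => x xx0; rewrite -PE /extension.
have bb : base x = base x0.
  apply: hat_inj => w; rewrite !hat_base; congr (_ + _); apply/eqP.
  rewrite eqz_mod_dvd; have /forallP/(_ w) := xx0.
  have -> : hat x w - corner w - (hat x0 w - corner w) = hat x w - hat x0 w by ring.
  by rewrite hatD hatN.
rewrite bb; congr quadratic; apply: funext => w; rewrite /n -bb hat_stepsE.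
rewrite rmorphD rmorphM /= addrAC subrr add0r mulfK //.
by rewrite pnatr_eq0 -lt0n.
Qed.

End ExtensionExists.

Section Conclusion.
Variable T : plumbing_tree.
Local Notation V := (vertex T).
Local Notation L' := (dual_lattice T).
Local Notation H := (discr T).

(** The class and the set J may depend on the point, but only through its class
    modulo L, which the periods N Estar w preserve. *)
Lemma count_below_extends (F : L' -> int) (hx : L' -> H) (J : L' -> {set V}) :
  (forall x, F x = count_below (hx x) (J x) x) ->
  (forall x l, l \in @in_L T -> hx (x + l) = hx x /\ J (x + l) = J x) ->
  exists2 f : L' -> rat, quasipolynomial f
    & forall x, chamber x -> f x = (F x)%:~R.
Proof.
move=> FE per; have [N N_gt0 [NL NB]] := count_below_mixed T.
have FN x l : l \in @in_L T -> F (x + l) = count_below (hx x) (J x) (x + l).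
  by move=> lL; rewrite FE; have [-> ->] := per x l lL.
have mixE x u w : mixed N F u w x = mixed N (count_below (hx x) (J x)) u w x.
  have FN2 := FN x _ (rpredD (NL u) (NL w)); rewrite addrA in FN2.
  by rewrite /mixed FN2 !FN // FE.
have mixed_periodic x u w t : in_domain x ->
    mixed N F u w (x + dEstar t *+ N) = mixed N F u w x.
  move=> xd; rewrite !mixE; have [-> ->] := per x _ (NL t).
  have [B BE] := NB (J x) u w; rewrite !BE //.
  by apply: in_domainD => // v; apply: hat_dEstarMn_ge0.
exists (extension N F); first exact: extension_quasipolynomial.
by move=> x /chamberP; apply: extension_domain.
Qed.

Lemma C_H_extends (h : H) : exists2 f : L' -> rat, quasipolynomial f
  & forall x, chamber x -> f x = (gcoef (C_H x) h)%:~R.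
Proof.
pose l0 : L' := repr (h : {ideal_quot @in_L T}).
have l0h : cls l0 = h by rewrite /cls reprK.
apply: (@count_below_extends _ (fun=> h) (fun x => [set i | x i - l0 i \is a
  Num.int]%SET)).
  by move=> x; rewrite -l0h C_H_count_below.
move=> x l /forallP lL; split=> //; apply/finset.setP => i; rewrite !inE dvalD.
by rewrite addrAC rpredDr.
Qed.

Lemma C_extends : exists2 f : L' -> rat, quasipolynomial f
  & forall x, chamber x -> f x = (C x)%:~R.
Proof.
apply: (@count_below_extends _ (@cls T) (fun=> [set: V]%SET)).
  move=> x; rewrite /C (C_H_count_below x x).
  suff -> : [set i | x i - x i \is a Num.int]%SET = [set: V]%SET by [].
  by apply/finset.setP => i; rewrite !inE subrr rpred0.
by move=> x l lL; split=> //; apply/eqP; rewrite clsE addrC addKr.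
Qed.

Lemma Q_extends (h : H) : exists2 f : L' -> rat, quasipolynomial f
  & forall x, chamber x -> f x = (Q h x)%:~R.
Proof.
apply: (@count_below_extends _ (fun=> h) (fun=> [set: V]%SET)) => // x.
exact: Q_count_below.
Qed.

Lemma unique_extension (F : L' -> int) :
  (exists2 f : L' -> rat, quasipolynomial f
    & forall x, chamber x -> f x = (F x)%:~R) ->
  exists! f : L' -> rat, quasipolynomial f /\
    (forall x, chamber x -> f x = (F x)%:~R).
Proof.
move=> [f fq fF]; exists f; split=> // g [gq gF].
by apply: quasipolynomial_eq => // x /chamberP xd; rewrite fF // gF.
Qed.

End Conclusion.

Theorem theorem12 (T : plumbing_tree) :
  [/\ exists! CC : dual_lattice T -> group_ring (discr T),
        equivariant_quasipolynomial CC
        /\ (forall x, chamber x -> CC x = C_H x),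
      exists! CC : dual_lattice T -> rat,
        quasipolynomial CC
        /\ (forall x, chamber x -> CC x = (C x)%:~R)
    & forall h : discr T,
      exists! LL : dual_lattice T -> rat,
        quasipolynomial LL
        /\ (forall x, chamber x -> LL x = (Q h x)%:~R)].
Proof.
split; last by move=> h; apply/unique_extension/Q_extends.
  have /choice[f fP] (h : discr T) : exists f : dual_lattice T -> rat,
      quasipolynomial f /\ forall x, chamber x -> f x = (gcoef (C_H x) h)%:~R.
    by have [f fq fC] := C_H_extends h; exists f.
  have fint h x : f h x \is a Num.int.
    have [fq fC] := fP h; apply: quasipolynomial_int x => // x /chamberP xc.
    by rewrite fC // intr_int.
  pose CC (x : dual_lattice T) : group_ring (discr T) :=
    [ffun h => Num.floor (f h x)].
  have CCE x h : (gcoef (CC x) h)%:~R = f h x.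
    by rewrite /gcoef ffunE floorK.
  exists CC; split.
    split=> [h|x xc].
      suff -> : (fun x => (gcoef (CC x) h)%:~R) = f h by case: (fP h).
      by apply: funext.
    apply/ffunP => h; apply: (@intr_inj rat); rewrite -[LHS]/((gcoef (CC x) h)%:~R) CCE.
    by case: (fP h) => _ ->.
  move=> CC' [q' C']; apply: funext => x; apply/ffunP => h.
  apply: (@intr_inj rat); rewrite -[LHS]/((gcoef (CC x) h)%:~R) CCE.
  have [fq fC] := fP h.
  have -> // : f h = (fun x => (gcoef (CC' x) h)%:~R).
  apply: quasipolynomial_eq fq (q' h) _ => {}x /chamberP xc.
  by rewrite fC // C'.
exact/unique_extension/C_extends.
Qed.
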